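(* Let $L,h,\lambda,\alpha,\beta>0$, let $\Omega=(-L,L)$ and let $g:\Omega\to\mathbb{R}$ be given by $g(x)=h\,\mathcal{X}_{(0,L)}(x)+\lambda x$, where $\mathcal{X}_{(0,L)}$ is the indicator function of $(0,L)$. Suppose that \[\beta<\alpha L+\frac{\lambda L^{3}}{6},\qquad \beta>\frac{4\alpha L}{3}-\frac{hL^{2}}{6},\qquad \beta>\frac{2\alpha L}{3},\qquad \beta<\frac{4\alpha L}{3}.\] Then the solution $u$ of \[\min_{u\in\mathrm{BV}(\Omega),\; w\in \mathrm{L}^{\infty}(\Omega)}\ \frac{1}{2}\|g-u\|_{\mathrm{L}^{2}(\Omega)}^{2}+\alpha \|Du-w\|_{\mathcal{M}}+\beta \|w\|_{\mathrm{L}^{\infty}(\Omega)}\] is \[u(x)=\begin{cases} \Big(\dfrac{6(\alpha L -\beta)}{L^{3}} +\lambda\Big)x+h-\dfrac{4\alpha L-3\beta}{L^{2}}, & x\in(0,L),\\[2mm] \Big(\dfrac{6(\alpha L -\beta)}{L^{3}} +\lambda\Big)x+\dfrac{4\alpha L-3\beta}{L^{2}}, & x\in(-L,0). \end{cases}\]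
   Context: $Du$ denotes the distributional derivative of $u\in\mathrm{BV}(\Omega)$, a finite Radon measure on $\Omega$; $w\in\mathrm{L}^\infty(\Omega)$ is identified with the measure $w\,dx$; and $\|\mu\|_{\mathcal{M}}$ denotes the Radon norm (total variation) of a measure $\mu$ on $\Omega$. ''The solution $u$'' means the $u$-component of a minimising pair $(u,w)$; functions are understood up to equality almost everywhere. *)

(* Defs.v *)
From HB Require Import structures.
From mathcomp Require Import all_boot all_order all_algebra.
From mathcomp Require Import all_classical all_reals all_analysis.

Set Implicit Arguments.
Unset Strict Implicit.
Unset Printing Implicit Defensive.

Import Order.TTheory GRing.Theory Num.Theory.
Import numFieldNormedType.Exports.

Local Open Scope classical_set_scope.
Local Open Scope ring_scope.

(* A measurable function on the interval ]-L, L[ is represented by a Borel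
   function R -> R whose values outside the interval are irrelevant, because
   Lebesgue measure is restricted to ]-L, L[ throughout.  Likewise, a finite
   Radon measure on ]-L, L[ is represented by a charge on R of which only the
   values on subsets of ]-L, L[ are used. *)

Section RadonMeasures.
Context {R : realType}.
Implicit Types (nu : {charge set (measurableTypeR R) -> \bar R}).

Lemma Hahn_sets_exist nu :
  exists PN : set (measurableTypeR R) * set (measurableTypeR R),
    hahn_decomposition nu PN.1 PN.2.
Proof. by have [P [N PN]] := Hahn_decomposition nu; exists (P, N). Qed.

(* The positive and negative parts of nu, hence the integral and the total
   variation below, do not depend on the choice of the Hahn decomposition. *)
Definition Hahn_sets nu := projT1 (cid (Hahn_sets_exist nu)).

Definition Hahn_setsP nu : hahn_decomposition nu (Hahn_sets nu).1 (Hahn_sets nu).2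
  := projT2 (cid (Hahn_sets_exist nu)).

Definition charge_integral nu (D : set (measurableTypeR R)) (phi : R -> R) : \bar R :=
  (\int[jordan_pos (Hahn_setsP nu)]_(x in D) (phi x)%:E
   - \int[jordan_neg (Hahn_setsP nu)]_(x in D) (phi x)%:E)%E.

Definition radon_norm nu (D : set (measurableTypeR R)) : \bar R :=
  charge_variation (Hahn_setsP nu) D.

End RadonMeasures.

Section BoundedVariation.
Context {R : realType} (L : R).

Definition Omega : set (measurableTypeR R) := `]- L, L[%classic.

Lemma measurable_Omega : measurable Omega.
Proof. exact: measurable_itv. Qed.

Lemma Omega_lty : (@lebesgue_measure R Omega < +oo)%E.
Proof. by rewrite /Omega lebesgue_measure_itv/=; case: ifP; rewrite -?EFinB ltry. Qed.

Definition leb : {finite_measure set (measurableTypeR R) -> \bar R} :=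
  mfrestr measurable_Omega Omega_lty.

Definition smooth (phi : R -> R) : Prop :=
  forall n x, derivable (phi^`(n))%classic x 1.

Definition test_function (phi : R -> R) : Prop :=
  [/\ smooth phi, compact (closure [set x | phi x != 0])
    & closure [set x | phi x != 0] `<=` Omega].

Definition is_distributional_derivative (u : R -> R)
    (nu : {charge set (measurableTypeR R) -> \bar R}) : Prop :=
  forall phi, test_function phi ->
    (\int[leb]_x (u x * (phi^`())%classic x)%:E = - charge_integral nu Omega phi)%E.

Definition BV (u : R -> R) : Prop :=
  u \in Lfun leb 1%E /\ exists nu, is_distributional_derivative u nu.

(* The derivative is unique as a measure on Omega; its default value outside
   BV is arbitrary. *)
Definition distributional_derivative (u : R -> R) : {charge set (measurableTypeR R) -> \bar R} :=
  match pselect (exists nu, is_distributional_derivative u nu) with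
  | left ex => projT1 (cid ex)
  | right _ => czero
  end.

Definition Linfty := LfunType leb (leey 1%E).

Lemma Linfty_integrable (w : Linfty) : leb.-integrable setT (EFin \o w).
Proof.
apply/Lfun1_integrable; apply: (@Lfun_subset _ _ _ leb 1%E +oo%E) => //.
- exact: leey.
- exact: fin_num_measure.
- exact: leey.
- exact: LfunP.
Qed.

Definition density (w : Linfty) : {charge set (measurableTypeR R) -> \bar R} :=
  induced_charge (Linfty_integrable w).

Definition energy (g : R -> R) (alpha beta : R) (u : R -> R) (w : Linfty) : \bar R :=
  ((2^-1)%:E * 'N[leb]_2%:E[EFin \o (g \- u)%R] ^+ 2
   + alpha%:E * radon_norm (cadd (distributional_derivative u) (copp (density w))) Omega
   + beta%:E * 'N[leb]_+oo[EFin \o w])%E.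

Definition minimising_pair (g : R -> R) (alpha beta : R) (u : R -> R) (w : Linfty) : Prop :=
  BV u /\
  forall (u' : R -> R) (w' : Linfty), BV u' ->
    (energy g alpha beta u w <= energy g alpha beta u' w')%E.

End BoundedVariation.

(* Main.v *)
Require Import Defs.
From mathcomp Require Import all_boot all_order all_algebra.
From mathcomp Require Import all_classical all_reals all_analysis.
From mathcomp Require Import measurable_realfun ess_sup_inf ring lra.

Set Implicit Arguments.
Unset Strict Implicit.
Unset Printing Implicit Defensive.

Import Order.TTheory GRing.Theory Num.Theory.
Import numFieldNormedType.Exports.

Local Open Scope classical_set_scope.
Local Open Scope ring_scope.

(* Let ubar be the claimed solution, c its slope and J its jump at 0, so that
   D ubar = J delta_0 + c dx, and let r = g - ubar, which is odd and affine on each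
   side of 0.  The function H(s) = \int_s^L r is a dual certificate: the four
   inequalities on beta give c >= 0, J >= 0 and 0 <= H <= alpha, while H(0) = alpha
   and \int H = beta.  If u has derivative nu then u(x) = C + nu(]-L, x]) for almost
   every x (test with smooth bumps converging to the indicator of ]p, q], at Lebesgue
   points p and q of u).  By Fubini, since \int r = 0,
     \int r u = \int H dnu = \int H d(nu - w) + \int H w
             <= alpha ||nu - w|| + beta ||w||_oo,
   with equality for u = ubar and w = c.  Expanding the square in
   |g - u|^2 = |r - (u - ubar)|^2 then shows that the energy of (u, w) exceeds that of
   (ubar, c) by at least |u - ubar|^2 / 2, hence minimality and uniqueness. *)

(** * A smooth step function *)

(** The certificate comes from the first-order optimality conditions: minus a primitive of the
    residual, vanishing at both ends, must be bounded by [alpha], equal [alpha] where D u - w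
    carries positive mass, and attain the norm bound [beta] against w. With a single upward jump at
    0 and a constant w the residual is 2 b x + a for x > 0 and 2 b x - a for x < 0, so H(s) = alpha
    - a |s| - b s^2. The normalisation H(L) = 0 and the condition that H has integral [beta] form a
    linear system in a and b, whose solution gives the coefficients in the theorem.

    H cannot serve as a test function: it has a kink at 0 and its support reaches the ends of the
    interval. The pairing of H with D u is therefore not an instance of the definition of D u, and
    goes through the representation of u and Fubini's theorem.

    A second obstacle is that the distributional derivative and the Hahn decompositions are
    arbitrary choices. The energy of the claimed solution can be evaluated only after showing that
    these choices do not affect it. *)

Section smooth_step.
Context {R : realType}.
Implicit Types (p : {poly R}) (f : R -> R).

(* For p = 1 this is the usual exp (-1/x); polynomials in 1/x are allowed so that
   the family is stable under differentiation. *)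
Definition flat p (x : R) : R := if 0 < x then p.[x^-1] * expR (- x^-1) else 0.

Lemma exprn_le_fact_expR n (y : R) : 0 <= y -> y ^+ n <= n`!%:R * expR y.
Proof.
move=> y0; case: n => [|n]; first by rewrite expr0 fact0 mul1r -expR0 ler_expR.
have := @expR_ge1Dxn R y n y0 => H.
rewrite -ler_pdivrMl ?ltr0n ?fact_gt0// mulrC.
by apply: le_trans H; rewrite lerDr.
Qed.

Lemma flat_bounded p : exists K, forall x, `|flat p x| <= K.
Proof.
exists (\sum_(i < size p) `|p`_i| * i`!%:R) => x.
have K0 : 0 <= \sum_(i < size p) `|p`_i| * (i`!%:R : R).
  by apply: sumr_ge0 => i _; rewrite mulr_ge0.
rewrite /flat; case: ifPn => x0; last by rewrite normr0.
rewrite normrM (ger0_norm (expR_ge0 _)) expRN ler_pdivrMr ?expR_gt0//.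
rewrite horner_coef (le_trans (ler_norm_sum _ _ _))// mulr_suml.
apply: ler_sum => i _; rewrite normrM -mulrA ler_wpM2l// ger0_norm.
  by rewrite exprn_le_fact_expR// invr_ge0 ltW.
by rewrite exprn_ge0// invr_ge0 ltW.
Qed.

(** Trading a factor [x] for a factor ['X] turns the uniform bound of [flat_bounded], valid for
    every polynomial, into decay of any order at 0. *)
Lemma flatMX p x : flat p x = x * flat (p * 'X) x.
Proof.
rewrite /flat; case: ifPn => x0; last by rewrite mulr0.
by rewrite hornerMX; field; rewrite gt_eqF.
Qed.

Lemma is_derive_flat p (x : R) :
  is_derive x (1 : R) (flat p) (flat ('X^2 * (p - p^`())) x).
Proof.
have [x0|x0|->] := ltgtP x 0.
- have -> : flat ('X^2 * (p - p^`())) x = 0 by rewrite /flat ltNge ltW.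
  apply: (@near_eq_is_derive _ _ _ (cst 0)).
  near=> y; rewrite /flat ltNge ltW//. near: y. exact: lt_nbhsl.
- pose f y := (horner p \o GRing.inv) y * (expR \o (-%R \o GRing.inv)) y.
  apply: (@near_eq_is_derive _ _ _ f).
    near=> y. rewrite /flat ifT//; near: y. exact: lt_nbhsr.
  have xu : x != 0 by rewrite gt_eqF.
  have inv : is_derive x (1 : R) (fun y : R => y^-1) (- x ^- 2 *: 1).
    exact: is_deriveV.
  apply: is_derive_eq.
  rewrite /flat x0 !hornerE /= /GRing.scale/=; field.
  done.
(* At 0 two factors are traded: one cancels the division by [h] in the difference quotient, the
   other sends the bounded remainder to 0. *)
- have [K hK] := flat_bounded (p * 'X * 'X).
  have flat0 q : flat q 0 = 0 by rewrite /flat ltxx.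
  have cvg0 : h^-1 *: (flat p (h *: (1 : R) + 0) - flat p 0) @[h --> (0 : R)^'] --> (0 : R).
    have -> : (fun h : R => h^-1 *: (flat p (h *: (1 : R) + 0) - flat p 0)) =
              (fun h => h * flat (p * 'X * 'X) h).
      apply/funext => h; rewrite flat0 subr0 addr0 /GRing.scale/= mulr1.
      have [->|h0] := eqVneq h 0; first by rewrite invr0 !mul0r.
      by rewrite [flat p h]flatMX [flat (p * 'X) h]flatMX mulKf.
    have K0 : 0 <= K by apply: le_trans (hK 0); exact: normr_ge0.
    apply/cvgr0Pnorm_lt => e e0; near=> h; rewrite normrM.
    apply: (@le_lt_trans _ _ (`|h| * (K + 1))).
      by rewrite ler_wpM2l// (le_trans (hK h))// lerDl.
    rewrite -ltr_pdivlMr ?ltr_wpDl//; near: h.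
    by apply: dnbhs0_lt; rewrite divr_gt0// ltr_wpDl.
  rewrite flat0; apply: DeriveDef; first by apply/cvg_ex; exists 0.
  exact: cvg_lim.
Unshelve. all: by end_near.
Qed.

(* Every member has a derivative which is again a member, so membership gives
   smoothness without any product or quotient rule of higher order. *)
Inductive smooth_algebra : (R -> R) -> Prop :=
| smooth_algebra_flat p : smooth_algebra (flat p)
| smooth_algebra_cst c : smooth_algebra (cst c)
| smooth_algebra_affine f a b :
    smooth_algebra f -> smooth_algebra (fun x => f (a * x + b))
| smooth_algebraD f g :
    smooth_algebra f -> smooth_algebra g -> smooth_algebra (fun x => f x + g x)
| smooth_algebraM f g :
    smooth_algebra f -> smooth_algebra g -> smooth_algebra (fun x => f x * g x)
| smooth_algebraV f : (forall x, f x != 0) ->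
    smooth_algebra f -> smooth_algebra (fun x => (f x)^-1).

Lemma smooth_algebra_derive f : smooth_algebra f ->
  exists2 df, smooth_algebra df & forall x : R, is_derive x (1 : R) f (df x).
Proof.
elim=> {f} [p|c|f a b sf [df sdf fdf]|f g sf [df sdf fdf] sg [dg sdg gdg]
    |f g sf [df sdf fdf] sg [dg sdg gdg]|f f0 sf [df sdf fdf]].
- by exists (flat ('X^2 * (p - p^`()))); [constructor|exact: is_derive_flat].
- by exists (cst 0); [constructor|move=> x; exact: is_derive_cst].
(* The constant is written [cst a x] so that the derivative is visibly a product of two members of
   the family. *)
- exists (fun x => df (a * x + b) * cst a x).
    by apply: smooth_algebraM; constructor.
  move=> x.
  have aff : is_derive x (1 : R) (fun y : R => a * y + b) a.
    apply: is_derive_eq.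
    by rewrite addr0 /GRing.scale/= mulr1.
  exact: (@is_derive1_comp _ f (fun y => a * y + b) x _ _ (fdf _) aff).
- exists (fun x => df x + dg x); first exact: smooth_algebraD.
  by move=> x; exact: is_deriveD.
- exists (fun x => f x * dg x + g x * df x).
    by apply: smooth_algebraD; exact: smooth_algebraM.
  move=> x; exact: is_deriveM.
- exists (fun x => (cst (-1) x * ((f x)^-1 * (f x)^-1)) * df x).
    by do ?[apply: smooth_algebraM|apply: smooth_algebraV] => //; constructor.
  move=> x; apply: (is_derive_eq (is_deriveV (f0 x) (fdf x))).
  rewrite /GRing.scale/= /cst; field.
  by rewrite f0.
Qed.

Lemma smooth_algebra_smooth f : smooth_algebra f -> smooth f.
Proof.
move=> sf n x; suff: smooth_algebra (f^`(n))%classic.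
  by move=> /smooth_algebra_derive[df _ /(_ x)[]].
elim: n => [|n ih]; first by rewrite derive1n0.
have [df sdf dfE] := smooth_algebra_derive ih.
rewrite derive1nS (_ : _^`()%classic = df)//.
by apply/funext => y; rewrite derive1E; have [_] := dfE y.
Qed.

(** The denominator never vanishes because [x] or [1 - x] is positive. The latter is written in the
    shape [a * x + b] of [smooth_algebra_affine]. *)
Definition step (x : R) : R := flat 1 x / (flat 1 x + flat 1 (-1 * x + 1)).

Lemma flat1_ge0 x : 0 <= flat 1 x.
Proof. by rewrite /flat; case: ifPn => // _; rewrite hornerC mul1r expR_ge0. Qed.

Lemma flat1_gt0 x : 0 < x -> 0 < flat 1 x.
Proof. by move=> x0; rewrite /flat x0 hornerC mul1r expR_gt0. Qed.

Lemma step_denominator_gt0 x : 0 < flat 1 x + flat 1 (-1 * x + 1).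
Proof.
have [x0|x0] := ltP 0 x; first by rewrite ltr_pwDl ?flat1_gt0 ?flat1_ge0.
by rewrite ltr_wpDl ?flat1_ge0// flat1_gt0//; lra.
Qed.

Lemma step_smooth_algebra : smooth_algebra step.
Proof.
have s1 : smooth_algebra (fun x => flat 1 (-1 * x + 1)).
  by apply: smooth_algebra_affine; constructor.
apply: smooth_algebraM; first by constructor.
apply: smooth_algebraV => [x|]; first by rewrite gt_eqF ?step_denominator_gt0.
by apply: smooth_algebraD => //; constructor.
Qed.

Lemma step_ge0 x : 0 <= step x.
Proof. by rewrite divr_ge0 ?flat1_ge0// ltW ?step_denominator_gt0. Qed.

Lemma step_le1 x : step x <= 1.
Proof.
by rewrite ler_pdivrMr ?step_denominator_gt0// mul1r lerDl flat1_ge0.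
Qed.

Lemma step_left x : x <= 0 -> step x = 0.
Proof. by move=> x0; rewrite /step {1}/flat ltNge x0 mul0r. Qed.

Lemma step_right x : 1 <= x -> step x = 1.
Proof.
move=> x1; have x0 : 0 < x by lra.
rewrite /step [flat 1 (_ * _ + _)](_ : _ = 0) ?addr0 ?divff// ?gt_eqF ?flat1_gt0//.
by rewrite /flat ltNge (_ : _ <= _)//; lra.
Qed.

End smooth_step.

(** * Smooth bumps approximating intervals *)

Section ramp.
Context {R : realType}.
Implicit Types (p q x : R) (n : nat).

Local Notation step := (@step R).

Lemma is_derive_step x : is_derive x (1 : R) step (step^`()%classic x).
Proof.
have /smooth_algebra_smooth sm := @step_smooth_algebra R.
by rewrite derive1E; apply: derivableP; exact: sm 0%N x.
Qed.

Lemma continuous_derive_step : continuous (step^`()%classic : R -> R).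
Proof.
have /smooth_algebra_smooth sm := @step_smooth_algebra R.
move=> x; apply: differentiable_continuous; apply/derivable1_diffP.
exact: sm 1%N x.
Qed.

Lemma derive_step_left x : x < 0 -> step^`()%classic x = 0.
Proof.
move=> x0; rewrite derive1E.
rewrite (@near_eq_derive _ _ _ _ (cst (0 : R))) ?derive_cst//.
near=> y; rewrite step_left// ltW//; near: y; exact: lt_nbhsl.
Unshelve. all: by end_near. Qed.

Lemma derive_step_right x : 1 < x -> step^`()%classic x = 0.
Proof.
move=> x0; rewrite derive1E.
rewrite (@near_eq_derive _ _ _ _ (cst (1 : R))) ?derive_cst//.
near=> y; rewrite step_right// ltW//; near: y; exact: lt_nbhsr.
Unshelve. all: by end_near. Qed.

Lemma derive_step_bounded : exists M, forall x, `|step^`()%classic x| <= M.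
Proof.
have cont : {within `[(0:R), 1], continuous (fun x => `|step^`()%classic x|)}.
  apply: continuous_subspaceT => x.
  by apply: continuous_comp; [exact: continuous_derive_step|exact: norm_continuous].
have [c _ cM] := EVT_max (@ler01 R) cont.
exists `|step^`()%classic c| => x.
have [x0|x0] := ltP x 0; first by rewrite derive_step_left// normr0.
have [x1|x1] := ltP 1 x; first by rewrite derive_step_right// normr0.
by apply: cM; rewrite in_itv/= x0 x1.
Qed.

(** The transition lies to the right of [p], so the limit in [n] is the indicator of the open ray.
    Differences of ramps then converge to indicators of left-open, right-closed intervals, the
    generators of the Borel sets used below. *)
Definition ramp p n x : R := step (n.+1%:R * x + - (n.+1%:R * p)).

Lemma ramp_smooth_algebra p n : smooth_algebra (ramp p n).
Proof. by apply: smooth_algebra_affine; exact: step_smooth_algebra. Qed.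

Lemma ramp_ge0 p n x : 0 <= ramp p n x. Proof. exact: step_ge0. Qed.
Lemma ramp_le1 p n x : ramp p n x <= 1. Proof. exact: step_le1. Qed.

Lemma ramp_left p n x : x <= p -> ramp p n x = 0.
Proof. by move=> xp; rewrite /ramp step_left// subr_le0 ler_wpM2l. Qed.

Lemma ramp_right p n x : p + n.+1%:R^-1 <= x -> ramp p n x = 1.
Proof.
move=> px; rewrite /ramp step_right// -mulrBr.
by rewrite -ler_pdivrMl ?mulr1 ?ltr0n// lerBrDl.
Qed.

Lemma is_derive_ramp p n x :
  is_derive x (1 : R) (ramp p n)
    (n.+1%:R * step^`()%classic (n.+1%:R * x + - (n.+1%:R * p))).
Proof.
have aff : is_derive x (1 : R) (fun y : R => n.+1%:R * y + - (n.+1%:R * p)) n.+1%:R.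
  apply: is_derive_eq; by rewrite subr0 /GRing.scale/= mulr1.
rewrite mulrC; exact: (@is_derive1_comp _ step _ x _ _ (is_derive_step _) aff).
Qed.

Lemma ramp_cvg p x : ramp p n x @[n --> \oo] --> (\1_(`]p, +oo[%classic : set R) x : R).
Proof.
rewrite indicE; have [xp|px] := leP x p.
  rewrite memNset/= ?in_itv/= ?andbT; last by rewrite ltNge xp.
  by apply: cvg_near_cst; apply: nearW => n; rewrite ramp_left.
rewrite mem_set/= ?in_itv/= ?px//.
apply: cvg_near_cst; near=> n; apply: ramp_right.
rewrite -lerBrDl; apply: ltW; near: n.
have xp0 : 0 < x - p by rewrite subr_gt0.
exact: (near_infty_natSinv_lt (PosNum xp0)).
Unshelve. all: by end_near. Qed.

End ramp.

Section bump.
Context {R : realType} (L : R).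
Implicit Types (p q x : R) (n : nat).

Definition bump p q n x : R := ramp p n x - ramp q n x.

Lemma bump_smooth_algebra p q n : smooth_algebra (bump p q n).
Proof.
rewrite (_ : bump p q n = (fun x => ramp p n x + cst (-1) x * ramp q n x)).
  apply: smooth_algebraD; first exact: ramp_smooth_algebra.
  by apply: smooth_algebraM; [exact: smooth_algebra_cst|exact: ramp_smooth_algebra].
by apply/funext => x; rewrite /bump /cst mulN1r.
Qed.

Lemma bump_test_function p q n : - L < p -> p <= q -> q + n.+1%:R^-1 < L ->
  test_function L (bump p q n).
Proof.
move=> Lp pq qL.
have sub : closure [set x | bump p q n x != 0] `<=` `[p, q + n.+1%:R^-1]%classic.
  have /closure_id -> : closed `[p, q + n.+1%:R^-1]%classic by exact: interval_closed.
  apply: closureS => x /=; rewrite in_itv/=; apply: contraR.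
  rewrite negb_and -!ltNge => /orP[xp|qx].
    by rewrite /bump !ramp_left ?subrr// ?ltW// (lt_le_trans xp).
  rewrite /bump !ramp_right ?subrr// ltW// (le_lt_trans _ qx)// lerD2r//.
split.
- exact/smooth_algebra_smooth/bump_smooth_algebra.
- apply: subclosed_compact sub; [exact: closed_closure|exact: segment_compact].
- apply: (subset_trans sub) => x; rewrite /Omega/= !in_itv/= => /andP[px xq].
  by rewrite (lt_le_trans Lp)//= (le_lt_trans xq).
Qed.

Lemma bump_cvg p q x : p <= q ->
  bump p q n x @[n --> \oo] --> (\1_(`]p, q]%classic : set R) x : R).
Proof.
move=> pq; rewrite (_ : \1_`]p, q] x =
    \1_(`]p, +oo[%classic : set R) x - \1_(`]q, +oo[%classic : set R) x).
  by apply: cvgB; exact: ramp_cvg.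
rewrite !indicE; have [xp|px] := leP x p; have [xq|qx] := leP x q.
- rewrite !memNset ?subrr//= in_itv/= ?andbT; apply/negP; rewrite -?leNgt//.
  by rewrite negb_and -leNgt xp.
- by have := le_lt_trans (le_trans xp pq) qx; rewrite ltxx.
- rewrite mem_set/= ?in_itv/= ?px// mem_set/= ?in_itv/= ?px// memNset ?subr0//=.
  by rewrite in_itv/= andbT; apply/negP; rewrite -leNgt.
- rewrite memNset/= ?in_itv/= ?px ?leNgt ?qx//.
  by rewrite !mem_set ?subrr//= in_itv/= ?px ?qx.
Qed.

Lemma bump_le1 p q n x : `|bump p q n x| <= 1.
Proof.
rewrite ler_norml; have := ramp_ge0 p n x; have := ramp_le1 p n x.
have := ramp_ge0 q n x; have := ramp_le1 q n x; rewrite /bump; lra.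
Qed.

End bump.

Lemma smooth_algebra_continuous {R : realType} (f : R -> R) :
  smooth_algebra f -> continuous f.
Proof.
move=> /smooth_algebra_derive[df _ dfE] x.
apply: differentiable_continuous; apply/derivable1_diffP.
by have [] := dfE x.
Qed.

(** * Integrals against charges and total variation *)

Section charge_integral.
Context {R : realType} (L : R).
Implicit Types (p q x : R) (n : nat)
  (m : {finite_measure set (measurableTypeR R) -> \bar R})
  (nu : {charge set (measurableTypeR R) -> \bar R}).

Local Notation Omega := (Omega L).
Local Notation pos nu := (jordan_pos (Hahn_setsP nu)).
Local Notation neg nu := (jordan_neg (Hahn_setsP nu)).

Lemma measurable_bump p q n (D : set (measurableTypeR R)) :
  measurable_fun D (EFin \o bump p q n).
Proof.
apply/measurable_EFinP; apply: measurable_funTS; apply: continuous_measurable_fun.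
exact/smooth_algebra_continuous/bump_smooth_algebra.
Qed.

Lemma integral_bump_cvg m p q : - L < p -> p <= q -> q < L ->
  (\int[m]_(x in Omega) (bump p q n x)%:E)%E @[n --> \oo] -->
  m (`]p, q]%classic : set (measurableTypeR R)).
Proof.
move=> Lp pq qL.
have mI : measurable (`]p, q]%classic : set (measurableTypeR R)).
  exact: measurable_itv.
have mO := measurable_Omega L.
have mbump n := @measurable_bump p q n Omega.
pose f := EFin \o (\1_(`]p, q]%classic : set (measurableTypeR R)) : _ -> R).
have mf : measurable_fun Omega f by apply/measurable_EFinP; exact: measurable_indic.
have bf : {ae m, forall x, Omega x -> (bump p q n x)%:E @[n --> \oo] --> f x}.
  apply/aeW => x _; apply: cvg_EFin; last exact: bump_cvg.
  exact: nearW.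
have i1 : m.-integrable Omega (cst 1%E) by exact: finite_measure_integrable_cst.
have b1 : {ae m, forall x n, Omega x -> (`|(bump p q n x)%:E| <= cst 1 x)%E}.
  by apply/aeW => x n _; rewrite lee_fin bump_le1.
have [_ _] := dominated_convergence mO mbump mf bf i1 b1.
rewrite integral_indic// setIidl// => x; rewrite /Omega/= !in_itv/= => /andP[px xq].
by rewrite (lt_trans Lp)//= (le_lt_trans xq).
Qed.

Lemma charge_jordanE nu (A : set (measurableTypeR R)) : measurable A ->
  nu A = (pos nu A - neg nu A)%E.
Proof. by move=> mA; rewrite (jordan_decomp (Hahn_setsP nu) mA) /cadd/= cscaleN1. Qed.

Lemma charge_integral_bump_cvg nu p q : - L < p -> p <= q -> q < L ->
  charge_integral nu Omega (bump p q n) @[n --> \oo] -->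
  nu (`]p, q]%classic : set (measurableTypeR R)).
Proof.
move=> Lp pq qL.
have mI : measurable (`]p, q]%classic : set (measurableTypeR R)).
  exact: measurable_itv.
rewrite charge_jordanE//; apply: cvgeB; last 2 first.
- exact: integral_bump_cvg.
- exact: integral_bump_cvg.
- by rewrite fin_num_adde_defr// fin_num_measure.
Qed.

(** The Hahn decomposition is an unspecified choice and cannot be computed. Whatever the negative
    set N is, the negative part of A is - nu (A [&] N), which is at most 0 when [nu] is nonnegative
    on subsets of [Omega]; hence it vanishes there. *)
Lemma charge_integral_measure nu (m : {measure set (measurableTypeR R) -> \bar R}) (phi : R -> R) :
  (forall A : set (measurableTypeR R), measurable A -> A `<=` Omega -> nu A = m A) ->
  charge_integral nu Omega phi = (\int[m]_(x in Omega) (phi x)%:E)%E.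
Proof.
move=> num; rewrite /charge_integral.
have [psP nsN PN PN0] := Hahn_setsP nu.
have neg0 A : measurable A -> A `<=` Omega -> neg nu A = 0%E.
  move=> mA AO; apply/eqP; rewrite eq_le measure_ge0 andbT.
  rewrite jordan_negE cjordan_negE /crestr0 mem_set// /crestr leeNl oppe0.
  have [mN _] := nsN.
  by rewrite (num _ (measurableI _ _ mA mN) (subset_trans (@subIsetl _ _ _) AO)).
have -> : (\int[neg nu]_(x in Omega) (phi x)%:E = 0)%E.
  rewrite -(integral_measure_zero Omega (fun x => (phi x)%:E)).
  by apply: eq_measure_integral => A mA AO; exact: neg0.
rewrite sube0; apply: eq_measure_integral => A mA AO.
transitivity (nu A); last exact: num.
by rewrite (charge_jordanE _ mA) neg0// sube0.
Qed.

Lemma radon_norm_measure nu (m : {measure set (measurableTypeR R) -> \bar R}) :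
  (forall A : set (measurableTypeR R), measurable A -> A `<=` Omega -> nu A = m A) ->
  radon_norm nu Omega = m Omega.
Proof.
move=> num; have mO := measurable_Omega L.
have [psP nsN PN PN0] := Hahn_setsP nu.
have neg0 : neg nu Omega = 0%E.
  apply/eqP; rewrite eq_le measure_ge0 andbT.
  rewrite jordan_negE cjordan_negE /crestr0 mem_set// /crestr leeNl oppe0.
  have [mN _] := nsN.
  by rewrite (num _ (measurableI _ _ mO mN) (@subIsetl _ _ _)).
rewrite /radon_norm /charge_variation neg0 adde0.
by rewrite -num// charge_jordanE// neg0 sube0.
Qed.

End charge_integral.

(** * Uniqueness of the distributional derivative *)

Section charge_uniqueness.
Context {R : realType} (L : R).
Implicit Types (p q x : R) (n : nat)
  (nu : {charge set (measurableTypeR R) -> \bar R}).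

Local Notation Omega := (Omega L).
Local Notation pos nu := (jordan_pos (Hahn_setsP nu)).
Local Notation neg nu := (jordan_neg (Hahn_setsP nu)).

Lemma itv_ocI (a b c d : R) : (`]a, b] `&` `]c, d] =
  `]Num.max a c, Num.min b d])%classic.
Proof.
apply/seteqP; split => x /=; rewrite !in_itv/= gt_max le_min.
  by move=> [/andP[-> ->] /andP[-> ->]].
by move=> /andP[/andP[-> ->] /andP[-> ->]].
Qed.

(** The hypothesis reaches only intervals with both ends strictly inside [Omega]. The two measures
    are therefore compared on each [K n], by uniqueness on the half-open intervals, which are stable
    under intersection; continuity from below along the increasing [K n] then covers [Omega]. *)
Lemma measure_eq_Omega (m1 m2 : {measure set (measurableTypeR R) -> \bar R}) :
  fin_num_fun m1 ->
  (forall p q, - L < p -> p <= q -> q < L ->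
    m1 (`]p, q]%classic : set (measurableTypeR R)) = m2 `]p, q]%classic) ->
  forall A : set (measurableTypeR R), measurable A -> A `<=` Omega -> m1 A = m2 A.
Proof.
move=> fm1 m12 A mA AO.
pose K n : set (measurableTypeR R) :=
  (`]- L + n.+1%:R^-1, L - n.+1%:R^-1])%classic.
have mK n : measurable (K n) by exact: measurable_itv.
have e0 n : 0 < n.+1%:R^-1 :> R by rewrite invr_gt0 ltr0n.
have eqK n : m1 (A `&` K n) = m2 (A `&` K n).
  apply: (@measure_unique _ R (measurableTypeR R) (@ocitv R)
    (fun n => `]1 *- n, n%:R]%classic) _ _ _ _ (mrestr m1 (mK n)) (mrestr m2 (mK n))) => //.
  - exact: ocitvI.
  - by move=> i; exists (1 *- i, i%:R).
  - exact: bigcup_itvT.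
  - move=> B [[a b] _ <-] /=; rewrite /mrestr itv_ocI.
    have [le|lt] := leP (Num.max a (- L + n.+1%:R^-1)) (Num.min b (L - n.+1%:R^-1)).
      apply: m12 => //; first by rewrite lt_max ltrDl e0 orbT.
      by rewrite gt_min gtrBl e0 orbT.
    by rewrite set_itv_ge ?measure0// -leNgt ltW.
  - move=> k; rewrite /= /mrestr -ge0_fin_numE ?measure_ge0//; apply: fm1.
    by apply: measurableI => //; exact: measurable_itv.
have AE : A = \bigcup_n (A `&` K n).
  rewrite -setI_bigcupr; apply/esym/setIidl => x /AO.
  rewrite /Omega/= in_itv/= => /andP[Lx xL].
  have lx0 : 0 < x + L by lra.
  have xl0 : 0 < L - x by lra.
  have near1 := near_infty_natSinv_lt (PosNum lx0).
  have near2 := near_infty_natSinv_lt (PosNum xl0).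
  have [n [n1 n2]] := filter_ex (filterI near1 near2).
  exists n => //; rewrite /K/= in_itv/=.
  by rewrite addrC ltrBlDr n1/= lerBrDr addrC -lerBrDr ltW.
have mAK n : measurable (A `&` K n) by exact: measurableI.
have ndAK : {homo (fun n => A `&` K n) : n m / (n <= m)%N >-> (n <= m)%O}.
  move=> n k nk; apply/subsetPset; apply: setIS => x.
  rewrite /K/= !in_itv/= => /andP[xl xr].
  have kn : k.+1%:R^-1 <= n.+1%:R^-1 :> R by rewrite lef_pV2 ?posrE ?ltr0n// ler_nat ltnS.
  by rewrite (le_lt_trans _ xl) ?lerD2l//= (le_trans xr)// lerD2l lerN2.
have := @nondecreasing_cvg_mu _ _ _ m1 _ mAK _ ndAK.
have := @nondecreasing_cvg_mu _ _ _ m2 _ mAK _ ndAK.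
rewrite -AE => /(_ mA) cvg2 /(_ mA) cvg1.
rewrite (_ : m1 \o _ = m2 \o (fun n => A `&` K n)) in cvg1; last exact/funext.
exact: cvg_unique cvg1 cvg2.
Qed.

Lemma sube_eq_swap (a b c d : \bar R) :
  a \is a fin_num -> b \is a fin_num -> c \is a fin_num -> d \is a fin_num ->
  (a - b = c - d <-> a + d = c + b)%E.
Proof.
move: a b c d => [a| |] [b| |] [c| |] [d| |] //= _ _ _ _.
by rewrite -!EFinD; split => -[H]; congr EFin; lra.
Qed.

(** Moving the negative Jordan parts to the other side turns the equality of two charges into an
    equality of two finite measures, to which [measure_eq_Omega] applies. *)
Lemma charge_eq_Omega nu1 nu2 :
  (forall p q, - L < p -> p <= q -> q < L ->
    nu1 (`]p, q]%classic : set (measurableTypeR R)) = nu2 `]p, q]%classic) ->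
  forall A : set (measurableTypeR R), measurable A -> A `<=` Omega -> nu1 A = nu2 A.
Proof.
move=> nu12.
pose m1 := measure_add (pos nu1) (neg nu2).
pose m2 := measure_add (pos nu2) (neg nu1).
have fm1 : fin_num_fun (m1 : set (measurableTypeR R) -> \bar R).
  by move=> A mA; rewrite /m1 measure_addE fin_numD !fin_num_measure.
have swap A : measurable A -> (nu1 A = nu2 A) <-> (m1 A = m2 A).
  move=> mA; rewrite (charge_jordanE nu1 mA) (charge_jordanE nu2 mA).
  by rewrite /m1 /m2 !measure_addE; apply: sube_eq_swap; exact: fin_num_measure.
move=> A mA AO; apply/(swap _ mA); apply: (measure_eq_Omega fm1) => // p q Lp pq qL.
by apply/swap; [exact: measurable_itv|exact: nu12].
Qed.

(** As [distributional_derivative] selects an arbitrary derivative, this is what permits replacing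
    it by an explicit one when the energy of the claimed solution is evaluated. *)
Lemma distributional_derivative_unique (u : R -> R) nu1 nu2 :
  is_distributional_derivative L u nu1 -> is_distributional_derivative L u nu2 ->
  forall A : set (measurableTypeR R), measurable A -> A `<=` Omega -> nu1 A = nu2 A.
Proof.
move=> u1 u2; apply: charge_eq_Omega => p q Lp pq qL.
have qL0 : 0 < L - q by lra.
have test : \forall n \near \oo, test_function L (bump p q n).
  near=> n; apply: bump_test_function => //; rewrite -ltrBrDl; near: n.
  exact: (near_infty_natSinv_lt (PosNum qL0)).
have cvg1 := @charge_integral_bump_cvg _ L nu1 _ _ Lp pq qL.
have cvg2 := @charge_integral_bump_cvg _ L nu2 _ _ Lp pq qL.
suff cvg2' : charge_integral nu1 Omega (bump p q n) @[n --> \oo] -->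
    nu2 (`]p, q]%classic : set (measurableTypeR R)).
  exact: cvg_unique cvg1 cvg2'.
apply: cvg_trans cvg2; apply: near_eq_cvg.
near=> n; apply: oppe_inj.
have t : test_function L (bump p q n) by near: n.
by rewrite -(u1 _ t) -(u2 _ t).
Unshelve. all: by end_near. Qed.

End charge_uniqueness.

(** * Integrability criteria and Lebesgue measure restricted to the interval *)

Section integration_tools.

Lemma integrable_mul_bounded d (T : measurableType d) (R : realType)
    (m : {measure set T -> \bar R}) (D : set T) (f h : T -> R) (M : R) :
  measurable D -> m.-integrable D (EFin \o f) -> measurable_fun D h ->
  (forall x, D x -> `|h x| <= M) -> m.-integrable D (fun x => (f x * h x)%:E).
Proof.
move=> mD fi mh hM.
have bh : [bounded h x | x in D].
  exists M; split; first exact: num_real.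
  by move=> M' MM' x Dx /=; rewrite (le_trans (hM _ Dx))// ltW.
exact: (integrableMl mD fi mh bh).
Qed.

Lemma finite_measure_bounded_integrable d (T : measurableType d) (R : realType)
    (m : {finite_measure set T -> \bar R}) (D : set T) (f : T -> R) (M : R) :
  measurable D -> measurable_fun D f -> (forall x, D x -> `|f x| <= M) ->
  m.-integrable D (EFin \o f).
Proof.
move=> mD mf fM; apply: measurable_bounded_integrable => //.
  by rewrite -ge0_fin_numE// fin_num_measure.
exists M; split; first exact: num_real.
by move=> M' MM' x Dx /=; rewrite (le_trans (fM x Dx))// ltW.
Qed.

Lemma integral_FTC (R : realType) (F f : R -> R) (a b : R) :
  a < b -> continuous f -> (forall x : R, is_derive x (1 : R) F (f x)) ->
  (\int[lebesgue_measure]_(x in `]a, b[) (f x)%:E)%E = (F b - F a)%:E.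
Proof.
move=> ab cf dF.
have cF : continuous F.
  move=> x; apply: differentiable_continuous; apply/derivable1_diffP.
  by have [] := dF x.
have mf (D : set (measurableTypeR R)) : measurable_fun D (EFin \o f).
  by apply/measurable_EFinP; apply: measurable_funTS; exact: continuous_measurable_fun.
rewrite integral_itv_bndo_bndc//; last exact: mf.
rewrite integral_itv_obnd_cbnd//; last exact: mf.
rewrite (@continuous_FTC2 _ f F) ?EFinB//.
- exact: continuous_subspaceT.
- split => [x _||]; first by have [] := dF x.
  + exact: cvg_at_right_filter (cF a).
  + exact: cvg_at_left_filter (cF b).
- by move=> x _; rewrite derive1E; have [_] := dF x.
Qed.

Lemma Rintegral_FTC (R : realType) (F f : R -> R) (a b : R) :
  a < b -> continuous f -> (forall x : R, is_derive x (1 : R) F (f x)) ->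
  \int[lebesgue_measure]_(x in `]a, b[) f x = F b - F a.
Proof. by move=> ab cf dF; rewrite /Rintegral (integral_FTC ab cf dF). Qed.

End integration_tools.

Section leb_integral.
Context {R : realType} (L : R).
Local Notation Omega := (Omega L).
Local Notation leb := (leb L).

Lemma lebE (A : set (measurableTypeR R)) : leb A = lebesgue_measure (A `&` Omega).
Proof. by []. Qed.

Lemma integral_leb (f : R -> \bar R) : measurable_fun [set: measurableTypeR R] f ->
  (\int[leb]_x f x = \int[lebesgue_measure]_(x in Omega) f x)%E.
Proof.
move=> mf; have mO := measurable_Omega L.
rewrite -(setvU Omega) integral_setU//; last 3 first.
- exact: measurableC.
- exact: measurable_funTS.
- by apply/disj_setPS => x [].
rewrite (_ : (\int[leb]_(x in ~` Omega) f x = 0)%E); last first.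
  rewrite -(integral_measure_zero (~` Omega) f).
  apply: eq_measure_integral => A mA AO.
  rewrite [LHS](_ : _ = lebesgue_measure (A `&` Omega))// (_ : A `&` Omega = set0) ?measure0//.
  by apply/disjoints_subset.
rewrite add0e; apply: eq_measure_integral => A mA AO.
by rewrite [LHS](_ : _ = lebesgue_measure (A `&` Omega))// setIidl.
Qed.

Lemma integral_leb_Omega (f : R -> \bar R) : measurable_fun [set: measurableTypeR R] f ->
  (\int[leb]_(x in Omega) f x = \int[leb]_x f x)%E.
Proof.
move=> mf; rewrite integral_leb//; apply: eq_measure_integral => A mA AO.
by rewrite [LHS](_ : _ = lebesgue_measure (A `&` Omega))// setIidl.
Qed.

Lemma integrable_leb (f : R -> \bar R) : measurable_fun [set: measurableTypeR R] f ->
  leb.-integrable setT f <-> lebesgue_measure.-integrable Omega f.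
Proof.
move=> mf; have mO := measurable_Omega L.
split => /integrableP[_ fi]; apply/integrableP; split => //.
- exact: measurable_funTS.
- by rewrite -integral_leb//; exact: measurableT_comp.
- by rewrite integral_leb//; exact: measurableT_comp.
Qed.

Lemma ae_leb (P : R -> Prop) : {ae lebesgue_measure, forall x, P x} ->
  {ae leb, forall x, P x}.
Proof.
move=> [N [mN N0 PN]]; exists N; split => //; rewrite lebE.
apply/eqP; rewrite eq_le measure_ge0 andbT -N0.
apply: le_measure => //; rewrite ?inE//.
  by apply: measurableI => //; exact: measurable_Omega.
Qed.

End leb_integral.

(** * Representation of functions of bounded variation *)

Section lebesgue_points.
Context {R : realType}.
Local Notation step := (@step R).
Local Notation mu := (@lebesgue_measure R).

(** A one-sided mollifier at [p]: the derivative of [ramp p n], concentrated between [p] and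
    [p + n.+1%:R^-1]. *)
Definition dramp (p : R) n x : R :=
  n.+1%:R * step^`()%classic (n.+1%:R * x + - (n.+1%:R * p)).

Lemma dramp_continuous p n : continuous (dramp p n).
Proof.
move=> x; apply: cvgM; first exact: cvg_cst.
have aff : n.+1%:R * y + - (n.+1%:R * p) @[y --> x] --> n.+1%:R * x + - (n.+1%:R * p).
  by apply: cvgD; [apply: cvgM; [exact: cvg_cst|exact: cvg_id]|exact: cvg_cst].
exact: (cvg_comp _ _ aff (@continuous_derive_step R _)).
Qed.

Lemma dramp_bounded : exists2 M : R, 0 <= M &
  forall (p : R) n (x : R), `|dramp p n x| <= n.+1%:R * M.
Proof.
have [M HM] := @derive_step_bounded R; exists M.
  by apply: le_trans (HM 0); exact: normr_ge0.
by move=> p n x; rewrite normrM ger0_norm// ler_wpM2l.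
Qed.

(** The radius is twice the width of the transition, so that outside the open ball the argument of
    the derivative of [step] is strictly below 0 or strictly above 1, as [derive_step_left] and
    [derive_step_right] require. *)
Lemma dramp_eq0 (p : R) n (x : R) : ~ ball p (2 / n.+1%:R) x -> dramp p n x = 0.
Proof.
rewrite -ball_normE /=; move=> /negP; rewrite -leNgt ler_normr => /orP[h|h].
  rewrite /dramp derive_step_left ?mulr0// -mulrBr pmulr_rlt0 ?ltr0n//.
  rewrite subr_lt0 -subr_gt0 (lt_le_trans _ h)// divr_gt0// ltr0n.
rewrite /dramp derive_step_right ?mulr0// -mulrBr.
rewrite -ltr_pdivrMl ?ltr0n// mulr1.
by rewrite opprB in h; rewrite (lt_le_trans _ h)// ltr_pMl ?invr_gt0 ?ltr0n// ltr1n.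
Qed.

Lemma integral_dramp (p : R) n : \int[mu]_(x in ball p (2 / n.+1%:R)) dramp p n x = 1.
Proof.
have r0 : 0 < 2 / n.+1%:R :> R by rewrite divr_gt0 ?ltr0n.
rewrite ball_itv (@Rintegral_FTC _ (ramp p n) (dramp p n) _ _ _ _ (is_derive_ramp p n)).
- rewrite ramp_right ?ramp_left ?subr0//; first by rewrite lerBlDr lerDl ltW.
  by rewrite lerD2l ler_pMl ?ler1n// invr_gt0 ltr0n.
- by rewrite ltrD2l gtrN.
- exact: dramp_continuous.
Qed.

(** On a ball of length [4 / n.+1%:R] the mollifier has integral 1 and is bounded by [n.+1%:R * M].
    The error is thus at most [4 * M] times the mean of |f - f p| over that ball, which tends to 0
    at a Lebesgue point. *)
Lemma lebesgue_pt_mollify (f : R -> R) p :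
  mu.-integrable setT (EFin \o f) -> lebesgue_pt f p ->
  \int[mu]_x (f x * dramp p n x) @[n --> \oo] --> f p.
Proof.
move=> fi fp; have [M M0 HM] := dramp_bounded.
pose r n : R := 2 / n.+1%:R.
have r0 n : 0 < r n by rewrite divr_gt0 ?ltr0n.
pose B n : set (measurableTypeR R) := ball p (r n).
have mB n : measurable (B n) by exact: measurable_ball.
have muB n : mu (B n) = (r n *+ 2)%:E by rewrite lebesgue_measure_ball// ltW.
have muBy n : (mu (B n) < +oo)%E by rewrite muB ltry.
have md n (D : set (measurableTypeR R)) : measurable_fun D (dramp p n).
  apply: measurable_funTS; apply: continuous_measurable_fun.
  exact: dramp_continuous.
have fB n : mu.-integrable (B n) (EFin \o f) by exact: (integrableS measurableT (mB n) (@subsetT _ _) fi).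
have cB n (c : R) : mu.-integrable (B n) (EFin \o cst c).
  apply: measurable_bounded_integrable => //.
    exact: muBy.
  exact: bounded_cst.
have fcB n : mu.-integrable (B n) (EFin \o (fun x => f x - f p)).
  by have := integrableB (mB n) (fB n) (cB n (f p)).
have bound n : `|\int[mu]_x (f x * dramp p n x) - f p| <= 4 * M * fine (davg f p (r n)).
  have -> : \int[mu]_x (f x * dramp p n x) = \int[mu]_(x in B n) (f x * dramp p n x).
    rewrite [RHS]Rintegral_mkcond; apply: eq_Rintegral => x _.
    by rewrite patchE; case: ifPn => // /negP; rewrite inE => /dramp_eq0 ->; rewrite mulr0.
  have -> : f p = \int[mu]_(x in B n) (f p * dramp p n x).
    rewrite RintegralZl ?integral_dramp ?mulr1//.
    apply: eq_integrable (integrable_mul_bounded (mB n) (cB n 1) (md n _) (fun x _ => HM p n x)) => //.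
    by move=> x _; rewrite /= mul1r.
  rewrite -RintegralB//; last 2 first.
  - exact: integrable_mul_bounded (mB n) (fB n) (md n _) (fun x _ => HM p n x).
  - exact: integrable_mul_bounded (mB n) (cB n (f p)) (md n _) (fun x _ => HM p n x).
  have fdi := integrable_mul_bounded (mB n) (fcB n) (md n _) (fun x _ => HM p n x).
  under eq_Rintegral do rewrite -mulrBl.
  apply: (le_trans (le_normr_Rintegral (mB n) fdi)).
  apply: (@le_trans _ _ (\int[mu]_(x in B n) ((n.+1%:R * M) * `|f x - f p|))).
    apply: le_Rintegral => //.
    - by have := integrable_abse fdi.
    - have := integrableZl (mB n) (n.+1%:R * M) (integrable_abse (fcB n)); exact.
    - by move=> x _; rewrite normrM mulrC ler_wpM2r.
  rewrite RintegralZl//; last exact: integrable_abse (fcB n).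
  rewrite /davg /iavg -/(B n) muB.
  rewrite (_ : (\int[mu]_(y in B n) `|((center (f p) \o f) y)%:E|)%E =
     (\int[mu]_(x in B n) `|f x - f p|)%:E); last first.
    rewrite /Rintegral fineK//.
    by apply: integrable_fin_num => //; exact: integrable_abse (fcB n).
  have rn0 : r n *+ 2 != 0 by rewrite mulrn_eq0/= gt_eqF.
  rewrite inver (negbTE rn0)/= /r.
  rewrite le_eqVlt; apply/orP; left; apply/eqP.
  rewrite -mulr_natr; field; rewrite ?pnatr_eq0//.
have rcvg : r n @[n --> \oo] --> (0 : R)^'+.
  move=> P [e /= e0 Pe]; change (\forall n \near \oo, P (r n)); near=> n.
  suff rne : r n < e.
    by apply: (Pe (r n)); rewrite ?r0//= sub0r normrN gtr0_norm// r0.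
  rewrite /r -ltr_pdivlMl//; near: n.
  have e2 : 0 < 2^-1 * e by rewrite mulr_gt0.
  exact: (near_infty_natSinv_lt (PosNum e2)).
have dcvg : fine (davg f p (r n)) @[n --> \oo] --> (0 : R).
  by apply: fine_cvg; exact: (cvg_comp _ _ rcvg fp).
apply: cvg_zero; apply: norm_cvg0.
apply: (@squeeze_cvgr _ _ _ _ (cst 0) (fun n => 4 * M * fine (davg f p (r n)))).
- by apply: nearW => n; rewrite normr_ge0 bound.
- exact: cvg_cst.
- by rewrite -[X in _ --> X](mulr0 (4 * M)); apply: cvgM => //; exact: cvg_cst.
Unshelve. all: by end_near. Qed.

End lebesgue_points.

Section representation.
Context {R : realType} (L : R).
Implicit Types (p q x : R) (nu : {charge set (measurableTypeR R) -> \bar R}).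
Local Notation Omega := (Omega L).
Local Notation leb := (leb L).
Local Notation mu := (@lebesgue_measure R).

Lemma derive1_bump p q n x : (bump p q n)^`()%classic x = dramp p n x - dramp q n x.
Proof.
rewrite derive1E; have dp := is_derive_ramp p n x; have dq := is_derive_ramp q n x.
by have [_ ->] := is_deriveB dp dq.
Qed.

Section increments.
Variables (u : R -> R) (uL : u \in Lfun leb 1%E).

Lemma Lfun_measurable : measurable_fun [set: measurableTypeR R] u.
Proof. by move: uL => /andP[/[1!inE]]. Qed.

(** The values of [u] outside [Omega] are arbitrary, so Lebesgue points are taken for its extension
    by 0, which is integrable on the whole line. *)
Lemma Lfun_restrict_integrable : mu.-integrable setT (EFin \o (u \_ Omega)).
Proof.
have mO := measurable_Omega L; rewrite -restrict_EFin.
apply: (iffLR (integrable_mkcond _ mO)).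
apply: (iffLR (integrable_leb L _)); last exact/Lfun1_integrable.
by apply/measurable_EFinP; exact: Lfun_measurable.
Qed.

Lemma integral_derive_bump p q n :
  (\int[leb]_x (u x * (bump p q n)^`()%classic x)%:E =
   (\int[mu]_x ((u \_ Omega) x * dramp p n x) -
    \int[mu]_x ((u \_ Omega) x * dramp q n x))%:E)%E.
Proof.
have mO := measurable_Omega L; have [M M0 HM] := @dramp_bounded R.
have md p' (D : set (measurableTypeR R)) : measurable_fun D (dramp p' n).
  apply: measurable_funTS; apply: continuous_measurable_fun.
  exact: dramp_continuous.
have fi p' : mu.-integrable setT (fun x => ((u \_ Omega) x * dramp p' n x)%:E).
  by apply: (integrable_mul_bounded _ Lfun_restrict_integrable (md _ _)) => // x _; exact: HM.
have fB : mu.-integrable setT (fun x =>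
    ((u \_ Omega) x * dramp p n x - (u \_ Omega) x * dramp q n x)%:E).
  by have := integrableB measurableT (fi p) (fi q).
rewrite -(RintegralB measurableT (fi p) (fi q)).
transitivity (\int[mu]_x
    ((u \_ Omega) x * dramp p n x - (u \_ Omega) x * dramp q n x)%:E)%E; last first.
  by rewrite /Rintegral fineK//; exact: (integrable_fin_num measurableT fB).
rewrite integral_leb; last first.
  apply/measurable_EFinP; apply: measurable_funM; first exact: Lfun_measurable.
  rewrite (_ : _^`()%classic = dramp p n \- dramp q n).
    by apply: measurable_funB.
  by apply/funext => x; rewrite derive1_bump.
rewrite integral_mkcond; apply: eq_integral => x _.
rewrite !patchE; case: ifPn => _; last by rewrite !mul0r subrr.
by rewrite derive1_bump mulrBr.
Qed.

Lemma charge_itv_increment nu p q : is_distributional_derivative L u nu ->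
  - L < p -> p <= q -> q < L ->
  lebesgue_pt (u \_ Omega) p -> lebesgue_pt (u \_ Omega) q ->
  nu (`]p, q]%classic : set (measurableTypeR R)) = (u q - u p)%:E.
Proof.
move=> unu Lp pq qL up uq.
have uE x : - L < x -> x < L -> (u \_ Omega) x = u x.
  by move=> Lx xL; rewrite patchE mem_set// /Omega/= in_itv/= Lx xL.
have qL0 : 0 < L - q by lra.
have test : \forall n \near \oo, test_function L (bump p q n).
  near=> n; apply: bump_test_function => //; rewrite -ltrBrDl; near: n.
  exact: (near_infty_natSinv_lt (PosNum qL0)).
have cp := lebesgue_pt_mollify Lfun_restrict_integrable up.
have cq := lebesgue_pt_mollify Lfun_restrict_integrable uq.
rewrite uE// in cp; last exact: le_lt_trans qL.
rewrite uE// in cq; last exact: lt_le_trans pq.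
have cnu : (- charge_integral nu Omega (bump p q n))%E @[n --> \oo] -->
    (- nu (`]p, q]%classic : set (measurableTypeR R)))%E.
  by apply: cvgeN; exact: charge_integral_bump_cvg.
have cE : (\int[mu]_x ((u \_ Omega) x * dramp p n x) -
    \int[mu]_x ((u \_ Omega) x * dramp q n x))%:E @[n --> \oo] --> (u p - u q)%:E.
  by apply: cvg_EFin; [exact: nearW|exact: cvgB].
suff cpq : (- charge_integral nu Omega (bump p q n))%E @[n --> \oo] --> (u p - u q)%:E.
  have H : (- nu (`]p, q]%classic : set (measurableTypeR R)))%E = (u p - u q)%:E.
    exact: cvg_unique cnu cpq.
  by rewrite -[LHS]oppeK H -EFinN opprB.
apply: cvg_trans cE; apply: near_eq_cvg; near=> n.
have t : test_function L (bump p q n) by near: n.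
by rewrite -(unu _ t) integral_derive_bump.
Unshelve. all: by end_near. Qed.

End increments.

(** For [x] in [Omega] this is the interval from -L, excluded, to [x], included. The intersection
    keeps it inside [Omega] for every real [x], so that it can be used under integrals over the
    whole line. *)
Definition lower x : set (measurableTypeR R) := (Omega `&` `]-oo, x]%classic).

Lemma measurable_lower x : measurable (lower x).
Proof. by apply: measurableI; [exact: measurable_Omega|exact: measurable_itv]. Qed.

Lemma lower_itv p q : - L < p -> p <= q -> q < L ->
  lower q = lower p `|` (`]p, q]%classic : set (measurableTypeR R)).
Proof.
move=> Lp pq qL; apply/seteqP; split => x; rewrite /lower/= /Omega/= !in_itv/=.
  by move=> [/andP[-> ->]] xq; rewrite xq andbT; case: leP => _; [left|right].
move=> [[/andP[-> ->]] xp|/andP[px xq]]; first by rewrite (le_trans xp).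
by rewrite xq (lt_trans Lp)// (le_lt_trans xq).
Qed.

(** The constant is fixed at one Lebesgue point [x0], which exists because [Omega] has positive
    measure. Any other Lebesgue point is compared with [x0] by [charge_itv_increment], whichever of
    the two comes first. *)
Lemma BV_representation (u : R -> R) nu : 0 < L -> u \in Lfun leb 1%E ->
  is_distributional_derivative L u nu ->
  exists C, {ae leb, forall x, Omega x -> u x = C + fine (nu (lower x))}.
Proof.
move=> L0 uL unu; set f := u \_ Omega; have mO := measurable_Omega L.
have aeL : {ae mu, forall x, lebesgue_pt f x}.
  apply: lebesgue_differentiation; apply: open_integrable_locally; first exact: openT.
  exact: Lfun_restrict_integrable.
have [x0 Ox0 x0L] : exists2 x0, Omega x0 & lebesgue_pt f x0.
  have [N [mN N0 PN]] := aeL; apply: contrapT => /forall2NP h.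
  have : (mu Omega <= mu N)%E.
    apply: le_measure; rewrite ?inE//; apply: subset_trans PN => x Ox /=.
    by have [|] := h x.
  rewrite N0 /Omega lebesgue_measure_itv/= lte_fin gtrN// -EFinB lee_fin; lra.
exists (u x0 - fine (nu (lower x0))).
have [N [mN N0 PN]] := ae_leb L aeL; exists N; split => //.
apply: subset_trans PN => x /=; apply: contra_not => xL Ox.
move: Ox Ox0; rewrite /Omega/= !in_itv/= => /andP[Lx xltL] /andP[Lx0 x0ltL].
have nuU p q : - L < p -> p <= q -> q < L -> lebesgue_pt f p -> lebesgue_pt f q ->
    fine (nu (lower q)) = fine (nu (lower p)) + (u q - u p).
  move=> Lp pq qL fp fq; rewrite (lower_itv Lp pq qL) chargeU//; first last.
  - apply/seteqP; split => // y; rewrite /lower/= !in_itv/= => -[[_ yp] /andP[py _]].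
    by have := le_lt_trans yp py; rewrite ltxx.
  - exact: measurable_lower.
  rewrite fineD ?fin_num_measure//; last exact: measurable_lower.
  by rewrite (charge_itv_increment uL unu).
have [le|/ltW le] := leP x0 x.
  by rewrite (nuU x0 x)//; lra.
by rewrite (nuU x x0)//; lra.
Qed.

End representation.

(** * Duality *)

Section upper_tail.
Context {R : realType} (L : R).
Local Notation Omega := (Omega L).
Local Notation leb := (leb L).
Variables (m : {finite_measure set (measurableTypeR R) -> \bar R}).
Variables (r k : R -> R) (M : R).
Hypothesis mr : measurable_fun [set: measurableTypeR R] r.
Hypothesis rM : forall x, `|r x| <= M.
Hypothesis ki : m.-integrable Omega (EFin \o k).

(** Closed at [s] so as to be dual to [lower]: both memberships express s <= x. The endpoint matters
    because the measure integrated over [s] may have atoms. *)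
Definition upper (s : R) : set (measurableTypeR R) := (`[s, +oo[)%classic.

Let f (z : measurableTypeR R * measurableTypeR R) : R :=
  (k \_ Omega) z.2 * (r z.1 * \1_(upper z.2) z.1).

Let kO_integrable : m.-integrable setT (EFin \o (k \_ Omega)).
Proof.
rewrite -restrict_EFin.
exact: (iffLR (integrable_mkcond _ (measurable_Omega L))).
Qed.

Let measurable_triangle : measurable_fun setT
  (fun z : measurableTypeR R * measurableTypeR R => \1_(upper z.2) z.1 : R).
Proof.
rewrite (_ : (fun z => _) =
  \1_[set z : measurableTypeR R * measurableTypeR R | z.2 <= z.1]).
  apply: measurable_indic; rewrite -[X in measurable X]setTI.
  exact: measurable_fun_ler.
by apply/funext => z; rewrite !indicE /upper; congr ((_ : bool)%:R);
  apply/idP/idP; rewrite !inE/= in_itv/= andbT.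
Qed.

Let f_integrable : (leb \x m)%E.-integrable setT (EFin \o f).
Proof.
have mkO : measurable_fun [set: measurableTypeR R] (k \_ Omega).
  by apply/measurable_EFinP; exact: measurable_int kO_integrable.
have k2 : (leb \x m)%E.-integrable setT (EFin \o ((k \_ Omega) \o snd)).
  apply/integrable21ltyP => //.
    by apply/measurable_EFinP; exact: (measurableT_comp mkO measurable_snd).
  have [c cE] : exists c, leb setT = c%:E.
    by exists (fine (leb setT)); rewrite fineK// fin_num_measure.
  have -> : (\int[m]_y \int[leb]_x `|(EFin \o ((k \_ Omega) \o snd)) (x, y)|)%E =
      (\int[m]_y (`|((k \_ Omega) y)%:E| * c%:E))%E.
    by apply: eq_integral => y _; rewrite -cE;
      exact: (integral_cst leb measurableT `|((k \_ Omega) y)%:E|%E).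
  by apply: integrable_lty => //; apply: integrableZr => //; exact: integrable_abse.
pose h (z : measurableTypeR R * measurableTypeR R) : R := r z.1 * \1_(upper z.2) z.1.
have mh : measurable_fun setT h.
  apply: measurable_funM; last exact: measurable_triangle.
  exact: (measurableT_comp mr measurable_fst).
have hM z : setT z -> `|h z| <= M.
  move=> _; rewrite normrM -[leRHS]mulr1 ler_pM//.
  by rewrite indicE; case: (_ \in _); rewrite ?normr1 ?normr0.
exact: (integrable_mul_bounded measurableT k2 mh hM).
Qed.

(** Both sides integrate r(x) k(s) over the triangle s <= x. The density [k] lets one statement
    serve twice: with [k = 1] and [m] a Jordan part of nu - w, and with [k = w] and [m] the
    restricted Lebesgue measure. *)
Lemma Fubini_lower :
  leb.-integrable setT (fun x => (r x * \int[m]_(s in lower L x) k s)%:E) /\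
  \int[leb]_x (r x * \int[m]_(s in lower L x) k s) =
  \int[m]_(s in Omega) (k s * \int[leb]_(x in upper s) r x).
Proof.
have mO := measurable_Omega L.
have F1 : (fun x => (r x * \int[m]_(s in lower L x) k s)%:E) =
    (fun x => \int[m]_s (EFin \o f) (x, s))%E.
  apply/funext => x.
  have kl : m.-integrable (lower L x) (EFin \o k).
    exact: (integrableS mO (measurable_lower L x) (@subIsetl _ _ _) ki).
  rewrite -(RintegralZl _ (measurable_lower L x) kl) /Rintegral fineK; last first.
    apply: integrable_fin_num; first exact: measurable_lower.
    have := integrableZl (measurable_lower L x) (r x) kl; exact.
  rewrite integral_mkcond; apply: eq_integral => s _.
  rewrite /f /= !patchE /lower /upper indicE in_setI.
  case: (s \in Omega) => /=; last by rewrite mul0r.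
  rewrite (_ : (s \in `]-oo, x]%classic) = (x \in `[s, +oo[%classic)).
    by case: (_ \in _); rewrite ?mulr1 ?mulr0// mulrC.
  by apply/idP/idP; rewrite !inE/= !in_itv/= andbT.
have ri (A : set (measurableTypeR R)) : measurable A -> leb.-integrable A (EFin \o r).
  by move=> mA; apply: (@finite_measure_bounded_integrable _ _ _ _ _ _ M) => //; exact: measurable_funTS.
have F2 : (fun s => ((k \_ Omega) s * \int[leb]_(x in upper s) r x)%:E) =
    (fun s => \int[leb]_x (EFin \o f) (x, s))%E.
  apply/funext => s.
  have mu_ : measurable (upper s) by exact: measurable_itv.
  rewrite -(RintegralZl _ mu_ (ri _ mu_)) /Rintegral fineK; last first.
    apply: integrable_fin_num => //.
    have := integrableZl mu_ ((k \_ Omega) s) (ri _ mu_); exact.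
  rewrite integral_mkcond; apply: eq_integral => x _.
  rewrite /f /= patchE indicE.
  by case: (_ \in _); rewrite ?mulr1 ?mulr0.
split.
  rewrite F1; exact: (integrable_fubini_F f_integrable).
transitivity (fine (\int[leb]_x \int[m]_s (EFin \o f) (x, s))%E); first by rewrite -F1.
rewrite (Fubini f_integrable).
transitivity (fine (\int[m]_(s in Omega) (k s * \int[leb]_(x in upper s) r x)%:E)%E);
  last by [].
rewrite -F2 [in RHS]integral_mkcond; congr fine; apply: eq_integral => s _.
by rewrite !patchE; case: ifPn => // _; rewrite mul0r.
Qed.

End upper_tail.

(** * Explicit integrals of piecewise smooth functions and of the residual *)

Section piecewise.
Context {R : realType} (L : R).
Hypothesis L_gt0 : 0 < L.
Local Notation Omega := (Omega L).
Local Notation leb := (leb L).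
Local Notation mu := (@lebesgue_measure R).

Lemma integral_piecewise (f f1 f2 F1 F2 : R -> R) (p : R) : p < 0 ->
  measurable_fun [set: measurableTypeR R] f ->
  continuous f1 -> continuous f2 ->
  (forall x : R, is_derive x (1 : R) F1 (f1 x)) ->
  (forall x : R, is_derive x (1 : R) F2 (f2 x)) ->
  (forall x : R, 0 < x < L -> f x = f1 x) -> (forall x : R, p < x < 0 -> f x = f2 x) ->
  (\int[mu]_(x in `]p, L[) (f x)%:E)%E = (F1 L - F1 0 + (F2 0 - F2 p))%:E.
Proof.
move=> p0 mf cf1 cf2 dF1 dF2 ff1 ff2.
have mfD (D : set (measurableTypeR R)) : measurable_fun D (EFin \o f).
  by apply/measurable_EFinP; exact: measurable_funTS.
(* The point 0 is put in the left piece and then discarded as a null set, so the value of [f] at the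
   jump is free. *)
have -> : (`]p, L[ = `]p, 0%R] `|` `]0%R, L[)%classic.
  apply/seteqP; split => x /=; rewrite !in_itv/=.
    by move=> /andP[-> ->]; rewrite andbT; case: leP => _; [left|right].
  move=> [/andP[-> x0]|/andP[x0 ->]]; first by rewrite (le_lt_trans x0).
  by rewrite (lt_trans p0).
rewrite integral_setU//; last first.
  apply/disj_setPS => x []/=; rewrite !in_itv/= => /andP[_ x0] /andP[x0' _].
  by have := le_lt_trans x0 x0'; rewrite ltxx.
rewrite -integral_itv_bndo_bndc//; last exact: mfD.
rewrite addrC EFinD -(integral_FTC p0 cf2 dF2) -(integral_FTC L_gt0 cf1 dF1).
congr (_ + _)%E; apply: eq_integral => x; rewrite inE/= in_itv/= => xI.
  by rewrite ff1.
by rewrite ff2.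
Qed.

Lemma integral_leb_piecewise (f f1 f2 F1 F2 : R -> R) :
  measurable_fun [set: measurableTypeR R] f ->
  continuous f1 -> continuous f2 ->
  (forall x : R, is_derive x (1 : R) F1 (f1 x)) ->
  (forall x : R, is_derive x (1 : R) F2 (f2 x)) ->
  (forall x : R, 0 < x < L -> f x = f1 x) -> (forall x : R, - L < x < 0 -> f x = f2 x) ->
  (\int[leb]_x (f x)%:E)%E = (F1 L - F1 0 + (F2 0 - F2 (- L)))%:E.
Proof.
move=> mf cf1 cf2 dF1 dF2 ff1 ff2.
rewrite integral_leb; last exact/measurable_EFinP.
by rewrite /Omega (integral_piecewise _ mf cf1 cf2 dF1 dF2)// oppr_lt0.
Qed.

Lemma Rintegral_leb_piecewise (f f1 f2 F1 F2 : R -> R) :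
  measurable_fun [set: measurableTypeR R] f ->
  continuous f1 -> continuous f2 ->
  (forall x : R, is_derive x (1 : R) F1 (f1 x)) ->
  (forall x : R, is_derive x (1 : R) F2 (f2 x)) ->
  (forall x : R, 0 < x < L -> f x = f1 x) -> (forall x : R, - L < x < 0 -> f x = f2 x) ->
  \int[leb]_x f x = F1 L - F1 0 + (F2 0 - F2 (- L)).
Proof.
move=> mf cf1 cf2 dF1 dF2 ff1 ff2.
by rewrite /Rintegral (integral_leb_piecewise mf cf1 cf2 dF1 dF2).
Qed.

Lemma integral_leb_upper (f : R -> R) (s : R) : measurable_fun [set: measurableTypeR R] f ->
  - L < s -> s < L ->
  (\int[leb]_(x in upper s) (f x)%:E = \int[mu]_(x in `]s, L[) (f x)%:E)%E.
Proof.
move=> mf Ls sL.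
have mfD (D : set (measurableTypeR R)) : measurable_fun D (EFin \o f).
  by apply/measurable_EFinP; exact: measurable_funTS.
have mU : measurable (upper s) by exact: measurable_itv.
rewrite integral_mkcond integral_leb; last first.
  by apply/(measurable_restrictT _ mU); exact: mfD.
rewrite -integral_mkcondr integral_itv_obnd_cbnd; last exact: mfD.
congr (integral _ _ _); apply/seteqP; split => x; rewrite /Omega /upper/= !in_itv/= andbT.
  by move=> [/andP[_ ->] ->].
by move=> /andP[sx ->]; rewrite sx (lt_le_trans Ls).
Qed.

(* The residual g - u of the claimed minimiser, for suitable a and b. *)
Definition residual (a b : R) (x : R) : R := 2 * b * x + (if 0 < x then a else - a).

Lemma measurable_residual a b : measurable_fun [set: measurableTypeR R] (residual a b).
Proof.
apply: measurable_funD; first by apply: measurable_funM => //.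
apply: measurable_fun_ifT => //.
by apply: measurable_fun_ltr.
Qed.

Lemma is_derive_quadratic (p q x : R) :
  is_derive x (1 : R) (fun y : R => q * y ^+ 2 + p * y) (2 * q * x + p).
Proof.
apply: is_derive_eq; rewrite /GRing.scale/=; ring.
Qed.

Lemma continuous_affine (p q : R) : continuous (fun x : R => q * x + p).
Proof.
by move=> x; apply: cvgD; [apply: cvgM; [exact: cvg_cst|exact: cvg_id]|exact: cvg_cst].
Qed.

Lemma Rintegral_residual_upper (a b s : R) : - L < s -> s < L ->
  \int[leb]_(x in upper s) residual a b x =
  (b * L ^+ 2 + a * L) - a * `|s| - b * s ^+ 2.
Proof.
move=> Ls sL; rewrite /Rintegral integral_leb_upper//; last exact: measurable_residual.
have [s0|s0] := leP 0 s.
  transitivity (fine (\int[mu]_(x in `]s, L[) (2 * b * x + a)%:E)%E).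
    congr fine; apply: eq_integral => x; rewrite inE/= in_itv/= => /andP[sx _].
    by rewrite /residual (le_lt_trans s0 sx).
  rewrite (integral_FTC sL (@continuous_affine a (2 * b)) (is_derive_quadratic a b)) /=.
  by rewrite ger0_norm//; ring.
rewrite (@integral_piecewise _ _ _ _ _ s s0 (measurable_residual a b)
  (@continuous_affine a (2 * b)) (@continuous_affine (- a) (2 * b))
  (is_derive_quadratic a b) (is_derive_quadratic (- a) b))/=.
- by rewrite ltr0_norm//; ring.
- by move=> x /andP[x0 _]; rewrite /residual x0.
- by move=> x /andP[_ x0]; rewrite /residual ltNge (ltW x0).
Qed.

Lemma Rintegral_residual a b : \int[leb]_x residual a b x = 0.
Proof.
rewrite (@Rintegral_leb_piecewise _ _ _ _ _ (measurable_residual a b)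
  (@continuous_affine a (2 * b)) (@continuous_affine (- a) (2 * b))
  (is_derive_quadratic a b) (is_derive_quadratic (- a) b)).
- by ring.
- by move=> x /andP[x0 _]; rewrite /residual x0.
- by move=> x /andP[_ x0]; rewrite /residual ltNge (ltW x0).
Qed.

End piecewise.

(** * The duality inequality *)

Section duality.
Context {R : realType} (L : R).
Hypothesis L_gt0 : 0 < L.
Local Notation Omega := (Omega L).
Local Notation leb := (leb L).
Implicit Types (nu : {charge set (measurableTypeR R) -> \bar R}) (w : Linfty L).

Lemma ae_leb_Omega (P : R -> Prop) :
  {ae leb, forall x, Omega x -> P x} -> {ae leb, forall x, P x}.
Proof.
move=> [N [mN N0 PN]]; have mO := measurable_Omega L.
have mC : measurable (~` Omega) by exact: measurableC.
exists (N `|` ~` Omega); split; first exact: measurableU.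
  have lebC : leb (~` Omega) = 0%E by rewrite lebE setICl measure0.
  apply/eqP; rewrite eq_le measure_ge0 andbT.
  by apply: (le_trans (measureU2 _ mN mC)); rewrite [X in (X + _)%E]N0 [X in (_ + X)%E]lebC adde0.
move=> x /= Px; have [Ox|nOx] := pselect (Omega x); [left|by right].
by apply: PN => /= h; exact: Px (h Ox).
Qed.

(** The norm of exponent [+oo] unfolds to an essential supremum only when the whole space has
    positive measure. *)
Lemma leb_setT_gt0 : (0 < leb setT)%E.
Proof.
rewrite lebE setTI /Defs.Omega lebesgue_measure_itv/= lte_fin gtrN// -EFinB lte_fin.
by have := L_gt0; lra.
Qed.

Lemma Linfty_norm_fin w : 'N[leb]_+oo[EFin \o w]%E \is a fin_num.
Proof. by rewrite ge0_fin_numE ?Lnorm_ge0//; exact: Lfunction_finite. Qed.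

Lemma Linfty_ae_le w :
  {ae leb, forall x, (`|w x|%:E <= 'N[leb]_+oo[EFin \o w])%E}.
Proof.
rewrite unlock leb_setT_gt0; exact: (@ess_sup_ge _ _ _ leb (abse \o (EFin \o w))).
Qed.

Section bound.
Variables (r H : R -> R) (M alpha : R).
Hypothesis mr : measurable_fun [set: measurableTypeR R] r.
Hypothesis rM : forall x, `|r x| <= M.
Hypothesis r0 : \int[leb]_x r x = 0.
Hypothesis mH : measurable_fun [set: measurableTypeR R] H.
Hypothesis H0 : forall s, Omega s -> 0 <= H s.
Hypothesis Ha : forall s, Omega s -> H s <= alpha.
Hypothesis HE : forall s, Omega s -> \int[leb]_(x in upper s) r x = H s.

Let H_norm s : Omega s -> `|H s| <= alpha.
Proof. by move=> Os; rewrite ger0_norm ?H0 ?Ha. Qed.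

Let finite_cst_integrable (m : {finite_measure set (measurableTypeR R) -> \bar R}) c :
  m.-integrable Omega (EFin \o (cst c : R -> R)).
Proof. by apply: finite_measure_integrable_cst; exact: measurable_Omega. Qed.

Let H_integrable (m : {finite_measure set (measurableTypeR R) -> \bar R}) :
  m.-integrable Omega (EFin \o H).
Proof.
exact: (finite_measure_bounded_integrable m (measurable_Omega L) (measurable_funTS mH) H_norm).
Qed.

(** The integral equals that of [H] against [m]. The upper bound will be applied to the positive
    Jordan part of nu - w and the lower bound to the negative part. *)
Lemma integral_H_measure (m : {finite_measure set (measurableTypeR R) -> \bar R}) :
  leb.-integrable setT (fun x => (r x * fine (m (lower L x)))%:E) /\
  0 <= \int[leb]_x (r x * fine (m (lower L x))) <= alpha * fine (m Omega).
Proof.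
have mO := measurable_Omega L.
have E x : fine (m (lower L x)) = \int[m]_(s in lower L x) cst 1 s.
  by rewrite Rintegral_cst ?mul1r//; exact: measurable_lower.
have [I1 I2] := Fubini_lower mr rM (finite_cst_integrable m 1).
have -> : (fun x => (r x * fine (m (lower L x)))%:E) =
    (fun x => (r x * \int[m]_(s in lower L x) cst 1 s)%:E).
  by apply/funext => x; rewrite E.
split=> //.
have -> : \int[leb]_x (r x * fine (m (lower L x))) = \int[m]_(s in Omega) H s.
  transitivity (\int[leb]_x (r x * \int[m]_(s in lower L x) cst 1 s)).
    by apply: eq_Rintegral => x _; rewrite E.
  rewrite I2; apply: eq_Rintegral => s; rewrite inE => Os.
  by rewrite /cst mul1r HE.
rewrite Rintegral_ge0//= -Rintegral_cst//.
exact: le_Rintegral (H_integrable m) (finite_cst_integrable m alpha) Ha.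
Qed.

Lemma integral_H_Linfty w :
  leb.-integrable setT (fun x => (r x * \int[leb]_(s in lower L x) w s)%:E) /\
  \int[leb]_x (r x * \int[leb]_(s in lower L x) w s) <=
    fine 'N[leb]_+oo[EFin \o w]%E * \int[leb]_(s in Omega) H s.
Proof.
have mO := measurable_Omega L.
have wi : leb.-integrable Omega (EFin \o w).
  exact: (integrableS measurableT mO (@subsetT _ _) (Linfty_integrable w)).
have [I1 I2] := Fubini_lower mr rM wi; split => //.
set N := fine _.
have wH := integrable_mul_bounded mO wi (measurable_funTS mH) H_norm.
have NH : leb.-integrable Omega (EFin \o (fun s => N * H s)).
  by have := integrableZl mO N (H_integrable leb).
rewrite I2 -RintegralZl//; last exact: H_integrable.
apply: (@le_trans _ _ (\int[leb]_(s in Omega) (`|w s * H s|))).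
  have -> : \int[leb]_(s in Omega) (w s * \int[leb]_(x in upper s) r x) =
      \int[leb]_(s in Omega) (w s * H s).
    by apply: eq_Rintegral => s; rewrite inE => Os; rewrite HE.
  apply: le_trans (le_normr_Rintegral mO wH); exact: ler_norm.
apply: fine_le.
- exact: integrable_fin_num (integrable_abse wH).
- exact: integrable_fin_num NH.
have [K [mK K0 PK]] := Linfty_ae_le w.
apply: ae_ge0_le_integral => //.
- exact: measurable_int (integrable_abse wH).
- move=> s Os; rewrite lee_fin mulr_ge0 ?H0//.
  by rewrite fine_ge0// Lnorm_ge0.
- exact: measurable_int NH.
exists K; split=> //; apply: subset_trans PK => s /=; apply: contra_not => h Os.
rewrite lee_fin normrM (ger0_norm (H0 Os)) ler_wpM2r ?H0//.
by rewrite -lee_fin /N fineK// Linfty_norm_fin.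
Qed.

Lemma duality_bound (u : R -> R) nu w : u \in Lfun leb 1%E ->
  is_distributional_derivative L u nu ->
  \int[leb]_x (r x * u x) <=
    alpha * fine (radon_norm (cadd nu (copp (density w))) Omega) +
    fine 'N[leb]_+oo[EFin \o w]%E * \int[leb]_(s in Omega) H s.
Proof.
move=> uL unu; have mO := measurable_Omega L.
set kappa := cadd nu (copp (density w)).
have [C uC] := BV_representation L_gt0 uL unu.
pose P := jordan_pos (Hahn_setsP kappa); pose Q := jordan_neg (Hahn_setsP kappa).
have nuE x : fine (nu (lower L x)) =
    fine (P (lower L x)) - fine (Q (lower L x)) + \int[leb]_(s in lower L x) w s.
  have ml := measurable_lower L x.
  have fd : density w (lower L x) \is a fin_num by exact: fin_num_measure.
  have dE : density w (lower L x) = (\int[leb]_(s in lower L x) w s)%:E.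
    by rewrite -[LHS]fineK.
  have fn : nu (lower L x) \is a fin_num by exact: fin_num_measure.
  have fP : P (lower L x) \is a fin_num by exact: fin_num_measure.
  have fQ : Q (lower L x) \is a fin_num by exact: fin_num_measure.
  have kE : (nu (lower L x) - density w (lower L x))%E = (P (lower L x) - Q (lower L x))%E.
    exact: (charge_jordanE kappa ml).
  rewrite dE in kE; have := congr1 fine kE.
  rewrite [fine (_ - _%:E)%E]fineB// [fine (P _ - _)%E]fineB//= => kE'.
  by rewrite -kE' subrK.
have [IP /andP[_ leP]] := integral_H_measure P.
have [IQ /andP[geQ _]] := integral_H_measure Q.
have [Iw lew] := integral_H_Linfty w.
have ri : leb.-integrable setT (EFin \o r).
  exact: (finite_measure_bounded_integrable leb measurableT mr (fun x _ => rM x)).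
have ICr : leb.-integrable setT (EFin \o (fun x => C * r x)).
  by have := integrableZl measurableT C ri.
pose v x := C * r x + (r x * fine (P (lower L x)) - r x * fine (Q (lower L x)) +
  r x * \int[leb]_(s in lower L x) w s).
have IPQ : leb.-integrable setT (EFin \o (fun x =>
    r x * fine (P (lower L x)) - r x * fine (Q (lower L x)))).
  by have := integrableB measurableT IP IQ.
have IPQw : leb.-integrable setT (EFin \o (fun x =>
    r x * fine (P (lower L x)) - r x * fine (Q (lower L x)) +
  r x * \int[leb]_(s in lower L x) w s)).
  by have := integrableD measurableT IPQ Iw.
have Iv : leb.-integrable setT (EFin \o v).
  by have := integrableD measurableT ICr IPQw.
have -> : \int[leb]_x (r x * u x) = \int[leb]_x v x.
  congr fine; apply: ae_eq_integral => //.
  - apply/measurable_EFinP; apply: measurable_funM => //; exact: Lfun_measurable uL.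
  - exact: measurable_int Iv.
  - have [K [mK K0 PK]] := ae_leb_Omega uC; exists K; split => //.
    apply: subset_trans PK => x /=; apply: contra_not => ux _.
    by rewrite ux nuE /v; congr EFin; ring.
rewrite /v RintegralD// RintegralZl// r0 mulr0 add0r RintegralD// RintegralB//.
have -> : fine (radon_norm kappa Omega) = fine (P Omega) + fine (Q Omega).
  rewrite /radon_norm /charge_variation/= fineD//; exact: fin_num_measure.
(* The negative part [Q] contributes at most 0 to the left-hand side, whereas the total variation
   counts it with weight [alpha]; the sign of [alpha], read off from the bounds on [H] at 0, absorbs
   the difference. *)
have alpha0 : 0 <= alpha.
  have O0 : Omega 0 by rewrite /Defs.Omega/= in_itv/= oppr_lt0 L_gt0.
  by rewrite (le_trans (H0 O0))// Ha.
have Q0 : 0 <= alpha * fine (Q Omega) by rewrite mulr_ge0// fine_ge0.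
by move: leP geQ lew; lra.
Qed.

End bound.
End duality.

(** * The derivative of the claimed solution *)

Section candidate.
Context {R : realType} (L : R).
Hypothesis L_gt0 : 0 < L.
Local Notation Omega := (Omega L).
Local Notation leb := (leb L).
Local Notation mu := (@lebesgue_measure R).
Implicit Types (f : R -> R).

Lemma eq_integral_leb f1 f2 : measurable_fun [set: measurableTypeR R] f1 ->
  measurable_fun [set: measurableTypeR R] f2 ->
  (forall x, Omega x -> f1 x = f2 x) ->
  (\int[leb]_x (f1 x)%:E = \int[leb]_x (f2 x)%:E)%E.
Proof.
move=> m1 m2 f12; rewrite !integral_leb; [|exact/measurable_EFinP..].
by apply: eq_integral => x; rewrite inE => /f12 ->.
Qed.

Lemma leb_bounded_integrable f (M : R) : measurable_fun [set: measurableTypeR R] f ->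
  (forall x, Omega x -> `|f x| <= M) -> leb.-integrable setT (EFin \o f).
Proof.
move=> mf fM; have mO := measurable_Omega L.
apply: (iffRL (integrable_leb L _)); first exact/measurable_EFinP.
apply: measurable_bounded_integrable => //; first exact: Omega_lty.
  exact: measurable_funTS.
exists M; split; first exact: num_real.
by move=> M' MM' x Dx /=; rewrite (le_trans (fM x Dx))// ltW.
Qed.

Lemma integrable_mul_bounded_leb f (h : R -> R) (M : R) : leb.-integrable setT (EFin \o f) ->
  measurable_fun [set: measurableTypeR R] h ->
  (forall x, Omega x -> `|h x| <= M) -> leb.-integrable setT (fun x => (h x * f x)%:E).
Proof.
move=> fi mh hM; have mO := measurable_Omega L.
have mf : measurable_fun [set: measurableTypeR R] f.
  by apply/measurable_EFinP; exact: measurable_int fi.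
have mEf : measurable_fun [set: measurableTypeR R] (EFin \o f).
  exact/measurable_EFinP.
have := integrable_mul_bounded mO (iffLR (integrable_leb L mEf) fi) (measurable_funTS mh) hM.
move=> hf; apply: (iffRL (integrable_leb L _)).
  by apply/measurable_EFinP; exact: measurable_funM.
by apply: eq_integrable hf => // x _ /=; rewrite mulrC.
Qed.

Lemma constant_Linfty (c : R) : exists2 w : Linfty L, (w : R -> R) = cst c &
  'N[leb]_+oo[EFin \o w]%E = `|c|%:E.
Proof.
have N : 'N[leb]_+oo[EFin \o cst c]%E = `|c|%:E.
  rewrite unlock leb_setT_gt0//.
  by rewrite -[RHS](ess_sup_cst `|c|%:E (leb_setT_gt0 L_gt0)).
have cL : (cst c : R -> R) \in Lfun leb +oo%E.
  apply/andP; split; rewrite inE//=.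
  by rewrite /finite_norm N ltry.
by exists (Lfun_Sub (leey 1%E) cL).
Qed.

Lemma density_constant (w : Linfty L) c (A : set (measurableTypeR R)) :
  (w : R -> R) = cst c -> measurable A -> density w A = (c%:E * leb A)%E.
Proof.
move=> wc mA; rewrite -(integral_cst leb mA c%:E).
transitivity (\int[leb]_(x in A) (w x)%:E)%E; first by [].
by apply: eq_integral => x _; rewrite wc.
Qed.

Lemma integral_mscale (m : {measure set (measurableTypeR R) -> \bar R})
    (D : set (measurableTypeR R)) (k : {nonneg R}) (f : R -> \bar R) :
  measurable D -> m.-integrable D f ->
  (\int[mscale k m]_(x in D) f x = k%:num%:E * \int[m]_(x in D) f x)%E.
Proof.
move=> mD fi; have mf := measurable_int _ fi.
rewrite integralE !ge0_integral_mscale//; last 2 first.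
- exact: measurable_funeneg.
- exact: measurable_funepos.
rewrite (integralE m D f).
have := integrable_fin_num mD (integrable_funeneg mD fi).
have := integrable_fin_num mD (integrable_funepos mD fi).
move: (integral m D f^\+)%E (integral m D f^\-)%E => [p| |] [q| |] //= _ _.
by rewrite -!EFinM -!EFinD mulrDr mulrN.
Qed.

(** The one-sided limits at 0 are [a] and [h - a], so the jump is [h - 2 * a]. *)
Definition piecewise_affine (c h a x : R) : R :=
  if 0 < x then c * x + h - a else c * x + a.

Lemma measurable_affine (p q : R) :
  measurable_fun [set: measurableTypeR R] (fun x : R => q * x + p).
Proof. exact: continuous_measurable_fun (@continuous_affine R p q). Qed.

Lemma measurable_piecewise_affine c h a :
  measurable_fun [set: measurableTypeR R] (piecewise_affine c h a).
Proof.
apply: measurable_fun_ifT; first exact: measurable_fun_ltr.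
  by apply: measurable_funB => //; exact: measurable_affine.
exact: measurable_affine.
Qed.

Lemma piecewise_affine_bounded c h a x : Omega x ->
  `|piecewise_affine c h a x| <= `|c| * L + `|h| + `|a|.
Proof.
rewrite /Defs.Omega/= in_itv/= => /andP[Lx xL].
have cx : `|c * x| <= `|c| * L.
  by rewrite normrM ler_wpM2l// ler_norml ltW//= ltW.
rewrite /piecewise_affine; case: ifP => _.
  by rewrite (le_trans (ler_normB _ _))// lerD// (le_trans (ler_normD _ _))// lerD.
by rewrite (le_trans (ler_normD _ _))// lerD// (le_trans cx)// lerDl.
Qed.

Lemma piecewise_affine_Lfun c h a : piecewise_affine c h a \in Lfun leb 1%E.
Proof.
apply/Lfun1_integrable; apply: leb_bounded_integrable.
  exact: measurable_piecewise_affine.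
exact: piecewise_affine_bounded.
Qed.

Lemma test_function_itv_ends (phi : R -> R) : test_function L phi -> phi L = 0 /\ phi (- L) = 0.
Proof.
move=> [_ _ sub].
have out x : ~ Omega x -> phi x = 0.
  move=> nOx; apply/eqP/negP => /negP px; apply: nOx; apply: sub.
  exact: subset_closure.
by split; apply: out; rewrite /Defs.Omega/= in_itv/= ltxx// andbF.
Qed.

Lemma test_function_continuous (phi : R -> R) : test_function L phi ->
  continuous phi /\ continuous (phi^`()%classic : R -> R).
Proof.
move=> [sm _ _]; split=> x; apply: differentiable_continuous; apply/derivable1_diffP.
  by have := sm 0%N x.
by have := sm 1%N x.
Qed.

Lemma continuous_bounded_Omega (phi : R -> R) : continuous phi ->
  exists M : R, forall x, Omega x -> `|phi x| <= M.
Proof.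
move=> cphi.
have cont : {within `[- L, L], continuous (fun x => `|phi x|)}.
  apply: continuous_subspaceT => x.
  by apply: continuous_comp; [exact: cphi|exact: norm_continuous].
have LL : - L <= L by have := L_gt0; lra.
have [c _ cM] := EVT_max LL cont.
exists `|phi c| => x; rewrite /Defs.Omega/= in_itv/= => /andP[Lx xL].
by apply: cM; rewrite in_itv/= !ltW.
Qed.

Section derivative.
Variables (c h a : R) (w : Linfty L).
Hypotheses (c_ge0 : 0 <= c) (J_ge0 : 0 <= h - 2 * a) (wc : (w : R -> R) = cst c).

Let jump : {finite_measure set (measurableTypeR R) -> \bar R} :=
  mscale (NngNum J_ge0) (\d_(0 : measurableTypeR R)).

(** The absolutely continuous part is written [density w], not as a multiple of [leb], so that
    subtracting [density w] in the energy leaves exactly the Dirac mass. *)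
Definition candidate_derivative : {charge set (measurableTypeR R) -> \bar R} :=
  cadd (charge_of_finite_measure jump) (density w).

(** On each side of 0 the product of the affine piece with [phi] is a primitive of the piece times
    the derivative of [phi], plus [c * phi]. The boundary terms vanish at both ends of the interval,
    and those at 0 add up to minus the jump times [phi 0]. *)
Lemma candidate_is_distributional_derivative :
  is_distributional_derivative L (piecewise_affine c h a) candidate_derivative.
Proof.
move=> phi tphi; have mO := measurable_Omega L.
have [cphi cdphi] := test_function_continuous tphi.
have [phiL phiNL] := test_function_itv_ends tphi.
have [M phiM] := continuous_bounded_Omega cphi.
have [M' dphiM] := continuous_bounded_Omega cdphi.
have mphi (D : set (measurableTypeR R)) : measurable_fun D phi.
  by apply: measurable_funTS; exact: continuous_measurable_fun.
have dphi x : is_derive x (1 : R) phi (phi^`()%classic x).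
  by have [/(_ 0%N x) sm _ _] := tphi; rewrite derive1E; exact: derivableP.
(* Slope and jump are nonnegative, so on [Omega] the derivative is a measure and [charge_integral]
   becomes an ordinary integral. *)
pose m := measure_add jump (mscale (NngNum c_ge0) leb).
rewrite (@charge_integral_measure _ _ _ m); last first.
  move=> A mA AO.
  transitivity (jump A + mscale (NngNum c_ge0) leb A)%E; last by rewrite -measure_addE.
  transitivity (jump A + density w A)%E; first by [].
  by rewrite (density_constant wc mA).
have phii (m' : {finite_measure set (measurableTypeR R) -> \bar R}) :
    m'.-integrable Omega (EFin \o phi).
  exact: (finite_measure_bounded_integrable m' mO (mphi _) phiM).
have O0 : Omega 0 by rewrite /Defs.Omega/= in_itv/= oppr_lt0 L_gt0.
rewrite integral_measure_add//; last 2 first.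
- exact: phii.
- exact: phii.
rewrite !integral_mscale//; last 2 first.
- exact: phii.
- exact: phii.
rewrite integral_dirac//; last by apply/measurable_EFinP; exact: mphi.
rewrite diracE mem_set// mul1e integral_leb_Omega; last first.
  by apply/measurable_EFinP; exact: mphi.
set pa := piecewise_affine c h a.
have pai : leb.-integrable setT (EFin \o pa).
  exact/Lfun1_integrable/piecewise_affine_Lfun.
have mdphi : measurable_fun [set: measurableTypeR R] (phi^`()%classic : R -> R).
  exact: continuous_measurable_fun.
have padi : leb.-integrable setT (fun x => (phi^`()%classic x * pa x)%:E).
  exact: integrable_mul_bounded_leb dphiM.
have phili : leb.-integrable setT (EFin \o phi).
  exact: leb_bounded_integrable phiM.
have cphili : leb.-integrable setT (fun x => (c * phi x)%:E).
  by have := integrableZl measurableT c phili.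
have dF p x : is_derive x (1 : R) (fun y => (c * y + p) * phi y)
    ((c * x + p) * phi^`()%classic x + c * phi x).
  have dp := dphi x; apply: is_derive_eq; rewrite /GRing.scale/=; ring.
have cF p : continuous (fun x => (c * x + p) * phi^`()%classic x + c * phi x).
  move=> x; apply: cvgD; apply: cvgM; [|exact: cdphi|exact: cvg_cst|exact: cphi].
  exact: continuous_affine.
have mf : measurable_fun [set: measurableTypeR R]
    (fun x => phi^`()%classic x * pa x + c * phi x).
  apply: measurable_funD; first exact: measurable_funM mdphi (measurable_piecewise_affine c h a).
  exact: measurable_funM (measurable_cst c) (mphi setT).
have := integral_leb_piecewise L_gt0 mf (cF (h - a)) (cF a) (dF (h - a)) (dF a).
rewrite phiL phiNL => key.
have {key} : (\int[leb]_x (phi^`()%classic x * pa x + c * phi x)%:E)%E =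
    (- ((h - 2 * a) * phi 0))%:E.
  rewrite key; first by congr EFin; ring.
  - by move=> x /andP[x0 _]; rewrite /pa /piecewise_affine x0; ring.
  - by move=> x /andP[_ x0]; rewrite /pa /piecewise_affine ltNge (ltW x0)/=; ring.
have -> : (\int[leb]_x (phi^`()%classic x * pa x + c * phi x)%:E)%E =
    (\int[leb]_x (phi^`()%classic x * pa x)%:E + \int[leb]_x (c * phi x)%:E)%E.
  by rewrite -integralD.
have -> : (\int[leb]_x (c * phi x)%:E)%E = (c%:E * \int[leb]_x (phi x)%:E)%E.
  by rewrite -integralZl.
have -> : (\int[leb]_x (pa x * phi^`()%classic x)%:E)%E =
    (\int[leb]_x (phi^`()%classic x * pa x)%:E)%E.
  by apply: eq_integral => x _; rewrite mulrC.
have := integrable_fin_num measurableT padi.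
have := integrable_fin_num measurableT phili.
rewrite /=; move: (\int[leb]_x (phi x)%:E)%E (\int[leb]_x (_ * pa x)%:E)%E.
move=> [I1| |] // [I2| |] // _ _; rewrite -!EFinM -!EFinD -EFinN => -[key].
by congr EFin; lra.
Qed.

Lemma piecewise_affine_BV : BV L (piecewise_affine c h a).
Proof.
split; first exact: piecewise_affine_Lfun.
by exists candidate_derivative; exact: candidate_is_distributional_derivative.
Qed.

Lemma piecewise_affine_radon_norm :
  radon_norm (cadd (distributional_derivative L (piecewise_affine c h a))
    (copp (density w))) Omega = (h - 2 * a)%:E.
Proof.
have mO := measurable_Omega L.
have dd : is_distributional_derivative L (piecewise_affine c h a)
    (distributional_derivative L (piecewise_affine c h a)).
  rewrite /distributional_derivative; case: pselect => [ex|[]].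
    by case: cid.
  by exists candidate_derivative; exact: candidate_is_distributional_derivative.
rewrite (@radon_norm_measure _ _ _ jump).
  transitivity ((h - 2 * a)%:E * \d_(0%R : measurableTypeR R) Omega)%E; first by [].
  rewrite diracE mem_set ?mule1//.
  by rewrite /Defs.Omega/= in_itv/= oppr_lt0 L_gt0.
move=> A mA AO.
transitivity (distributional_derivative L (piecewise_affine c h a) A - density w A)%E.
  by [].
rewrite (distributional_derivative_unique dd candidate_is_distributional_derivative mA AO).
transitivity (jump A + density w A - density w A)%E; first by [].
by rewrite addeK//; exact: fin_num_measure.
Qed.

End derivative.

End candidate.

(** * Minimality and uniqueness *)

Section minimality.
Context {R : realType} (L h lambda a b c alpha beta : R).
Hypothesis L_gt0 : 0 < L.
Hypothesis a_ge0 : 0 <= a.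
Hypothesis b_bound : 0 <= a + 2 * b * L.
Hypothesis c_ge0 : 0 <= c.
Hypothesis J_ge0 : 0 <= h - 2 * a.
Hypothesis alphaE : alpha = b * L ^+ 2 + a * L.
Hypothesis betaE : beta = a * L ^+ 2 + 4 / 3 * b * L ^+ 3.
Hypothesis cE : c = lambda - 2 * b.

Local Notation Omega := (Omega L).
Local Notation leb := (leb L).
Local Notation mu := (@lebesgue_measure R).
Local Notation ubar := (piecewise_affine c h a).
Local Notation res := (residual a b).

Let g (x : R) : R := h * \1_(`]0, L[%classic : set R) x + lambda * x.

(* The dual certificate: minus the primitive of the residual vanishing at both ends. *)
Definition certificate (s : R) : R := alpha - a * `|s| - b * s ^+ 2.

Lemma measurable_g : measurable_fun [set: measurableTypeR R] g.
Proof.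
by apply: measurable_funD; apply: measurable_funM.
Qed.

Lemma residualE x : Omega x -> g x - ubar x = res x.
Proof.
rewrite /Defs.Omega/= in_itv/= => /andP[Lx xL].
rewrite /g /piecewise_affine /residual indicE.
case: ifPn => x0.
  by rewrite mem_set/= ?in_itv/= ?x0// cE; ring.
by rewrite memNset/= ?in_itv/= ?(negbTE x0)// cE; ring.
Qed.

Lemma residual_bounded x : Omega x -> `|res x| <= 2 * `|b| * L + `|a|.
Proof.
rewrite /Defs.Omega/= in_itv/= => /andP[Lx xL].
have xL' : `|x| <= L by rewrite ler_norml !ltW.
rewrite /residual (le_trans (ler_normD _ _))// lerD//.
  by rewrite !normrM (ger0_norm (ler0n _ 2)) ler_wpM2l// mulr_ge0.
by case: ifP; rewrite ?normrN.
Qed.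

Lemma residual_sqr_integrable :
  leb.-integrable setT (EFin \o (fun x => res x ^+ 2)).
Proof.
apply: (@leb_bounded_integrable _ _ _ ((2 * `|b| * L + `|a|) ^+ 2)).
  apply: measurable_funX; exact: measurable_residual.
move=> x /residual_bounded rM; rewrite normrX lerXn2r// nnegrE.
exact: le_trans rM.
Qed.

Lemma certificate_bounds s : Omega s -> 0 <= certificate s <= alpha.
Proof.
rewrite /Defs.Omega/= in_itv/= => /andP[Ls sL].
have : `|s| <= L by rewrite ler_norml !ltW.
have : 0 <= `|s| by [].
rewrite /certificate -[s ^+ 2]real_normK ?num_real// alphaE.
move: `|s| => t t0 tL.
have e1 : 0 <= a + b * t.
  have -> : a + b * t = (a * (2 * L - t) + (a + 2 * b * L) * t) / (2 * L).
    by field; rewrite gt_eqF.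
  apply: divr_ge0; last by rewrite mulr_ge0// ltW.
  by rewrite addr_ge0// mulr_ge0//; lra.
have e2 : 0 <= a + b * (L + t).
  have -> : a + b * (L + t) = (a * (L - t) + (a + 2 * b * L) * (L + t)) / (2 * L).
    by field; rewrite gt_eqF.
  apply: divr_ge0; last by rewrite mulr_ge0// ltW.
  by rewrite addr_ge0// mulr_ge0//; lra.
apply/andP; split.
  have -> : b * L ^+ 2 + a * L - a * t - b * t ^+ 2 = (L - t) * (a + b * (L + t)) by ring.
  by rewrite mulr_ge0// subr_ge0.
rewrite -subr_ge0 (_ : _ - _ = t * (a + b * t)); last by ring.
by rewrite mulr_ge0.
Qed.

Lemma measurable_certificate : measurable_fun [set: measurableTypeR R] certificate.
Proof.
apply: measurable_funB; first apply: measurable_funB => //.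
  apply: measurable_funM => //; exact: measurableT_comp.
by apply: measurable_funM => //; exact: measurable_funX.
Qed.

Lemma Rintegral_certificate : \int[leb]_(s in Omega) certificate s = beta.
Proof.
rewrite {1}/Rintegral integral_leb_Omega; last first.
  by apply/measurable_EFinP; exact: measurable_certificate.
have dF p (x : R) : is_derive x (1 : R)
    (fun y : R => alpha * y + p / 2 * y ^+ 2 - b / 3 * y ^+ 3) (alpha + p * x - b * x ^+ 2).
  by apply: is_derive_eq; rewrite /GRing.scale/=; field.
have cF p : continuous (fun x : R => alpha + p * x - b * x ^+ 2).
  move=> x; apply: cvgB; last by apply: cvgM; [exact: cvg_cst|exact: exprn_continuous].
  by apply: cvgD; [exact: cvg_cst|apply: cvgM; [exact: cvg_cst|exact: cvg_id]].
rewrite (integral_leb_piecewise L_gt0 measurable_certificate (cF (- a)) (cF a) (dF (- a)) (dF a)).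
- by rewrite /= alphaE betaE; field.
- by move=> x /andP[x0 _]; rewrite /certificate gtr0_norm//; ring.
- by move=> x /andP[_ x0]; rewrite /certificate ltr0_norm//; ring.
Qed.

(** The equality case of [residual_duality], checked by direct integration of a quadratic polynomial
    on each side of 0. *)
Lemma Rintegral_residual_candidate :
  \int[leb]_x (res x * ubar x) = alpha * (h - 2 * a) + beta * c.
Proof.
(* The pair [q] holds the intercepts of the two affine factors, of slopes [p] and [p']. *)
have dF p q p' (x : R) : is_derive x (1 : R)
    (fun y : R => p * p' / 3 * y ^+ 3 + (p * q.2 + q.1 * p') / 2 * y ^+ 2 + q.1 * q.2 * y)
    ((p * x + q.1) * (p' * x + q.2)).
  by apply: is_derive_eq; rewrite /GRing.scale/=; field.
have cF p q p' : continuous (fun x : R => (p * x + q.1) * (p' * x + q.2)).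
  by move=> x; apply: cvgM; exact: continuous_affine.
have mf : measurable_fun [set: measurableTypeR R] (fun x => res x * ubar x).
  apply: measurable_funM; first exact: measurable_residual.
  exact: measurable_piecewise_affine.
rewrite (Rintegral_leb_piecewise L_gt0 mf (cF (2 * b) (a, h - a) c) (cF (2 * b) (- a, a) c)
  (dF (2 * b) (a, h - a) c) (dF (2 * b) (- a, a) c)).
- by rewrite /= alphaE betaE; field.
- by move=> x /andP[x0 _]; rewrite /residual /piecewise_affine x0/=; ring.
- by move=> x /andP[_ x0]; rewrite /residual /piecewise_affine ltNge (ltW x0)/=; ring.
Qed.

Lemma residual_duality (u : R -> R)
    (nu : {charge set (measurableTypeR R) -> \bar R}) (w : Linfty L) : u \in Lfun leb 1%E ->
  is_distributional_derivative L u nu ->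
  \int[leb]_x (res x * u x) <=
    alpha * fine (radon_norm (cadd nu (copp (density w))) Omega) +
    fine 'N[leb]_+oo[EFin \o w]%E * beta.
Proof.
move=> uL unu; have mO := measurable_Omega L.
(* The residual may be unbounded on the line, while [duality_bound] asks for a global bound;
   truncation to [Omega] leaves the integrals against [leb] unchanged. *)
pose r := res \_ Omega.
have mr : measurable_fun [set: measurableTypeR R] r.
  apply/(measurable_restrictT _ mO); apply: measurable_funTS; exact: measurable_residual.
have rM x : `|r x| <= 2 * `|b| * L + `|a|.
  rewrite /r patchE; case: ifPn => [|_]; first by rewrite inE; exact: residual_bounded.
  by rewrite normr0 addr_ge0// mulr_ge0// ?ltW// mulr_ge0.
have rE x : Omega x -> r x = res x by move=> Ox; rewrite /r patchE mem_set.
have r0 : \int[leb]_x r x = 0.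
  rewrite -(Rintegral_residual L_gt0 a b); congr fine.
  apply: eq_integral_leb => //; exact: measurable_residual.
have HE s : Omega s -> \int[leb]_(x in upper s) r x = certificate s.
  move=> Os; have := Os; rewrite /Defs.Omega/= in_itv/= => /andP[Ls sL].
  rewrite /certificate alphaE -(Rintegral_residual_upper L_gt0 a b Ls sL); congr fine.
  rewrite !integral_leb_upper//; last exact: measurable_residual.
  apply: eq_integral => x; rewrite inE/= in_itv/= => /andP[sx xL].
  by rewrite rE// /Defs.Omega/= in_itv/= xL (lt_trans Ls).
have H0 s : Omega s -> 0 <= certificate s by move=> /certificate_bounds/andP[].
have Ha s : Omega s -> certificate s <= alpha by move=> /certificate_bounds/andP[].
have -> : \int[leb]_x (res x * u x) = \int[leb]_x (r x * u x).
  congr fine; apply: eq_integral_leb.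
  - by apply: measurable_funM; [exact: measurable_residual|exact: Lfun_measurable uL].
  - by apply: measurable_funM => //; exact: Lfun_measurable uL.
  - by move=> x /rE ->.
rewrite -Rintegral_certificate.
exact: (duality_bound L_gt0 mr rM r0 measurable_certificate H0 Ha HE w uL unu).
Qed.

Lemma Lnorm2_sqr (f : R -> R) :
  ('N[leb]_2%:E[EFin \o f] ^+ 2 = \int[leb]_x (f x ^+ 2)%:E)%E.
Proof.
transitivity ('N[leb]_2%:E[EFin \o f] `^ 2)%E.
  have := Lnorm_ge0 leb 2%:E (EFin \o f).
  case: ('N[leb]_2%:E[EFin \o f])%E => [x| |]//= x0.
    by rewrite powR_mulrn// EFin_expe.
  by rewrite pnatr_eq0/=.
rewrite poweR_Lnorm ?pnatr_eq0//; apply: eq_integral => x _ /=.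
by rewrite powR_mulrn// real_normK ?num_real.
Qed.

Lemma radon_norm_fin (nu : {charge set (measurableTypeR R) -> \bar R}) :
  radon_norm nu Omega \is a fin_num /\ (0 <= radon_norm nu Omega)%E.
Proof.
have mO := measurable_Omega L; rewrite /radon_norm /charge_variation; split.
  by rewrite fin_numD !fin_num_measure.
by rewrite /= adde_ge0.
Qed.

Definition minimum : R :=
  2^-1 * \int[leb]_x (res x ^+ 2) + (alpha * (h - 2 * a) + beta * c).

Lemma energy_candidate (w : Linfty L) : (w : R -> R) = cst c ->
  'N[leb]_+oo[EFin \o w]%E = `|c|%:E ->
  energy g alpha beta ubar w = minimum%:E.
Proof.
move=> wc Nw; rewrite /energy Nw Lnorm2_sqr ger0_norm//.
rewrite (piecewise_affine_radon_norm L_gt0 c_ge0 J_ge0 wc).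
rewrite (@eq_integral_leb _ L _ (fun x => res x ^+ 2)); last 3 first.
- apply: measurable_funX; apply: measurable_funB; first exact: measurable_g.
  exact: measurable_piecewise_affine.
- apply: measurable_funX; exact: measurable_residual.
- by move=> x Ox; rewrite /= residualE.
rewrite -[X in (_ * X)%E](fineK (integrable_fin_num measurableT residual_sqr_integrable)).
by rewrite -!EFinM -!EFinD /minimum addrA.
Qed.

Lemma energy_lower_bound (u : R -> R) (w : Linfty L) : BV L u ->
  (minimum%:E + 2^-1%:E * \int[leb]_x ((u x - ubar x) ^+ 2)%:E <=
   energy g alpha beta u w)%E.
Proof.
move=> [uL exnu].
have unu : is_distributional_derivative L u (distributional_derivative L u).
  by rewrite /distributional_derivative; case: pselect => // ex; case: cid.
have dual := residual_duality w uL unu.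
have [rfin rge0] := radon_norm_fin
  (cadd (distributional_derivative L u) (copp (density w))).
have Nfin := Linfty_norm_fin w.
have Nge0 := Lnorm_ge0 leb +oo%E (EFin \o w).
rewrite /energy Lnorm2_sqr; move: dual rfin rge0 Nfin Nge0.
case: (radon_norm _ _) => [rn| |]//; case: ('N[leb]_+oo[_])%E => [N| |]//.
move=> dual _ rn0 _ N0; rewrite !lee_fin in rn0 N0.
have {}dual : \int[leb]_x (res x * u x) <= alpha * rn + N * beta := dual.
have mu_ : measurable_fun [set: measurableTypeR R] u := Lfun_measurable uL.
have mub := measurable_piecewise_affine c h a.
have mres := measurable_residual a b.
(* A competitor is only known to be integrable. If [g - u] is not square integrable, its energy is
   infinite and the bound is trivial. *)
have [gui|] := pselect (leb.-integrable setT (EFin \o (fun x => (g x - u x) ^+ 2))); last first.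
  move=> ngui.
  have -> : (\int[leb]_x ((g \- u) x ^+ 2)%:E = +oo)%E.
    apply: contrapT => noo; apply: ngui; apply/integrableP; split.
      apply/measurable_EFinP; apply: measurable_funX.
      by apply: measurable_funB => //; exact: measurable_g.
    under eq_integral => x _ do rewrite gee0_abs ?lee_fin ?sqr_ge0//.
    by rewrite ltey; apply/eqP.
  by rewrite gt0_muley ?lte_fin// -!EFinM !addye// leey.
have ri2 := residual_sqr_integrable.
have ru : leb.-integrable setT (EFin \o (fun x => res x * u x)).
  apply: (integrable_mul_bounded_leb _ mres residual_bounded).
  exact/Lfun1_integrable.
have rub : leb.-integrable setT (EFin \o (fun x => res x * ubar x)).
  apply: (integrable_mul_bounded_leb _ mres residual_bounded).
  exact/Lfun1_integrable/piecewise_affine_Lfun.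
(* With r = g - ubar, the sum of [A] and [B] is (u - ubar)^2 on [Omega], but each of the two is
   integrable on its own. *)
pose A x := (g x - u x) ^+ 2 - res x ^+ 2.
pose B x := 2 * (res x * u x - res x * ubar x).
have Ai : leb.-integrable setT (EFin \o A).
  by have := integrableB measurableT gui ri2.
have Bi0 : leb.-integrable setT (EFin \o (fun x => res x * u x - res x * ubar x)).
  by have := integrableB measurableT ru rub.
have Bi : leb.-integrable setT (EFin \o B).
  by have := integrableZl measurableT 2 Bi0.
have ABi : leb.-integrable setT (EFin \o (fun x => A x + B x)).
  by have := integrableD measurableT Ai Bi.
have -> : (\int[leb]_x ((u x - ubar x) ^+ 2)%:E = \int[leb]_x (A x + B x)%:E)%E.
  apply: eq_integral_leb.
  - by apply: measurable_funX; exact: measurable_funB.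
  - by apply/measurable_EFinP; exact: measurable_int ABi.
  - by move=> x Ox; rewrite /A /B -(residualE Ox); ring.
have -> : (\int[leb]_x ((g \- u) x ^+ 2)%:E = (\int[leb]_x ((g x - u x) ^+ 2))%:E)%E.
  by rewrite /Rintegral fineK//; exact: (integrable_fin_num measurableT gui).
have -> : (\int[leb]_x (A x + B x)%:E = (\int[leb]_x (A x + B x))%:E)%E.
  by rewrite /Rintegral fineK//; exact: (integrable_fin_num measurableT ABi).
rewrite RintegralD// RintegralB// RintegralZl// RintegralB//.
rewrite Rintegral_residual_candidate -!EFinM -!EFinD lee_fin /minimum.
by move: dual; lra.
Qed.

Lemma piecewise_affine_unique_minimiser :
  (exists w : Linfty L, minimising_pair g alpha beta ubar w) /\
  (forall (u : R -> R) (w : Linfty L), minimising_pair g alpha beta u w ->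
     u = ubar %[ae leb]).
Proof.
have [w0 w0c w0N] := constant_Linfty L_gt0 c.
have bv := piecewise_affine_BV L_gt0 c_ge0 J_ge0 w0c.
have sq_ge0 u : (0 <= \int[leb]_x ((u x - ubar x) ^+ 2)%:E)%E.
  by apply: integral_ge0 => x _; rewrite lee_fin sqr_ge0.
split.
  exists w0; split=> // u w uBV; rewrite (energy_candidate w0c w0N).
  apply: le_trans (energy_lower_bound w uBV).
  by rewrite leeDl// mule_ge0// lee_fin.
move=> u w [uBV /(_ ubar w0 bv)]; rewrite (energy_candidate w0c w0N) => le.
have := le_trans (energy_lower_bound w uBV) le.
rewrite -[leRHS]adde0 leeD2lE// pmule_rle0 ?lte_fin// => le0.
have mu_ : measurable_fun [set: measurableTypeR R] u by case: uBV => /Lfun_measurable.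
have md : measurable_fun [set: measurableTypeR R] (fun x => (u x - ubar x) ^+ 2).
  apply: measurable_funX; apply: measurable_funB => //.
  exact: measurable_piecewise_affine.
have /ae_eq_integral_abs : (\int[leb]_x `|((u x - ubar x) ^+ 2)%:E| = 0)%E.
  under eq_integral => x _ do rewrite gee0_abs ?lee_fin ?sqr_ge0//.
  by apply/eqP; rewrite eq_le le0 sq_ge0.
move=> /(_ measurableT); case=> [|K [mK K0 PK]]; first exact/measurable_EFinP.
exists K; split => //; apply: subset_trans PK => x /=; apply: contra_not => uE _.
have /= [/eqP] := uE I; rewrite sqrf_eq0 subr_eq0 => /eqP; exact.
Qed.

End minimality.

Theorem mainTheorem3 (R : realType) (L h lambda alpha beta : R)
  (L_gt0 : 0 < L) (h_gt0 : 0 < h) (lambda_gt0 : 0 < lambda)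
  (alpha_gt0 : 0 < alpha) (beta_gt0 : 0 < beta)
  (beta_lt1 : beta < alpha * L + lambda * L ^+ 3 / 6)
  (beta_gt1 : beta > 4 * alpha * L / 3 - h * L ^+ 2 / 6)
  (beta_gt2 : beta > 2 * alpha * L / 3)
  (beta_lt2 : beta < 4 * alpha * L / 3) :
  let g : R -> R := fun x => h * \1_(`]0, L[%classic : set R) x + lambda * x in
  let ubar : R -> R := fun x =>
    if 0 < x
    then (6 * (alpha * L - beta) / L ^+ 3 + lambda) * x
         + h - (4 * alpha * L - 3 * beta) / L ^+ 2
    else (6 * (alpha * L - beta) / L ^+ 3 + lambda) * x
         + (4 * alpha * L - 3 * beta) / L ^+ 2 in
  (exists w : Linfty L, minimising_pair g alpha beta ubar w) /\
  (forall (u : R -> R) (w : Linfty L), minimising_pair g alpha beta u w ->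
     u = ubar %[ae leb L]).
Proof.
have L2 : 0 < L ^+ 2 by exact: exprn_gt0.
have L3 : 0 < L ^+ 3 by exact: exprn_gt0.
have Lneq0 : L != 0 by rewrite gt_eqF.
(* These [a] and [b] solve alpha = b L^2 + a L and beta = a L^2 + (4/3) b L^3, the conditions that
   the certificate vanishes at L and has integral [beta]; then c = lambda - 2 b. *)
pose a := (4 * alpha * L - 3 * beta) / L ^+ 2.
pose b := 3 * (beta - alpha * L) / L ^+ 3.
pose c := 6 * (alpha * L - beta) / L ^+ 3 + lambda.
(* Each sign condition is one hypothesis on [beta] with denominators cleared: [beta_lt2] for [a],
   [beta_gt2] for [a + 2 * b * L], [beta_lt1] for [c] and [beta_gt1] for the jump. *)
have a_ge0 : 0 <= a by apply: divr_ge0; lra.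
have b_bound : 0 <= a + 2 * b * L.
  rewrite (_ : _ + _ = (3 * beta - 2 * alpha * L) / L ^+ 2); last by rewrite /a /b; field.
  by apply: divr_ge0; lra.
have c_ge0 : 0 <= c.
  rewrite (_ : c = (6 * (alpha * L - beta) + lambda * L ^+ 3) / L ^+ 3).
    by apply: divr_ge0; lra.
  by rewrite /c; field.
have J_ge0 : 0 <= h - 2 * a.
  rewrite (_ : _ - _ = (h * L ^+ 2 - 8 * alpha * L + 6 * beta) / L ^+ 2).
    by apply: divr_ge0; lra.
  by rewrite /a; field.
apply: (@piecewise_affine_unique_minimiser R L h lambda a b c alpha beta) => //.
- by rewrite /a /b; field.
- by rewrite /a /b; field.
- by rewrite /c /b; field.
Qed.
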